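(* Let $(Z,M)$ be a Möbius space that satisfies the (symmetry)-condition. Then there exists a complete strong Möbius space $(\overline{Z},\overline{M})$ together with a Möbius embedding $i_Z:Z\hookrightarrow\overline{Z}$ such that $i_Z(Z)$ is dense in $\overline{Z}$ (with respect to the Möbius topology), and with the following property: if $(Z',M')$ is a complete strong Möbius space with a Möbius embedding $i:Z\hookrightarrow Z'$ such that $i(Z)$ is dense in $Z'$, then there exists a unique Möbius equivalence $f:\overline{Z}\to Z'$ such that $i=f\circ i_Z$.
   Context: Tuples. A tuple of points of $Z$ is admissible if no three of its entries (at distinct positions) coincide, and non-degenerate if its entries are pairwise distinct. $\mathcal{A}$ is the set of admissible quadruples in $Z^4$. Let $L_4=\{(x,y,z)\in\mathbb{R}^3\mid x+y+z=0\}$ and $\overline{L_4}=L_4\cup\{(0,\infty,-\infty),(-\infty,0,\infty),(\infty,-\infty,0)\}$. Let $E_1=(12)(34)$, $E_2=(13)(42)$, $E_3=(14)(23)$ be the three pairings of $\{1,2,3,4\}$ (pairs of opposite edges of a tetrahedron). For $\pi\in\mathcal{S}_4$ let $\varphi(\pi)\in\mathcal{S}_3$ be given by $\pi(E_i)=E_{\varphi(\pi)(i)}$. $\mathcal{S}_4$ acts by $\pi(z_1,\dots,z_4)=(z_{\pi(1)},\dots,z_{\pi(4)})$ and $\varphi(\pi)(u_1,u_2,u_3)=(u_{\varphi(\pi)(1)},u_{\varphi(\pi)(2)},u_{\varphi(\pi)(3)})$. Möbius structure. Let $Z$ have at least three points. A map $M=(a,b,c):\mathcal{A}\to\overline{L_4}$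 is a Möbius structure, and $(Z,M)$ a Möbius space, if: 1) $M(\pi P)=\mathrm{sgn}(\pi)\varphi(\pi)M(P)$ for all $P\in\mathcal{A}$, $\pi\in\mathcal{S}_4$; 2) for $P\in\mathcal{A}$: $M(P)\in L_4$ iff $P$ is non-degenerate; 3) $M(x,x,y,z)=(0,\infty,-\infty)$ whenever $(x,x,y,z)\in\mathcal A$; 4) for every admissible $5$-tuple $(x,y,\omega,\alpha,\beta)$ with $(\omega,\alpha,\beta)$ non-degenerate, $\alpha\ne x\ne\beta$, $\alpha\neq y\neq\beta$, there is $\lambda\in\mathbb{R}\cup\{\pm\infty\}$ with $M(\alpha,x,\omega,\beta)+M(\alpha,\omega,y,\beta)-M(\alpha,x,y,\beta)=(\lambda,-\lambda,0)$; moreover the first component of the left side is well-defined whenever $(\omega,\alpha,\beta)$ is non-degenerate, $x\neq\beta$, $y\ne\alpha$, and the second whenever $(\omega,\alpha,\beta)$ is non-degenerate, $x\neq\alpha$, $y\neq\beta$. Cross ratio triple. Let $\overline\Delta=\{(a:b:c)\in\mathbb{R}P^2\mid a,b,c>0\}\cup\{(0:1:1),(1:0:1),(1:1:0)\}$. The map $crt:\mathcal{A}\to\overline\Delta$ associated with $M$ is $crt(P)=(e^{(c-b)/3}:e^{(a-c)/3}:e^{(b-a)/3})$ if $M(P)=(a,b,c)\in L_4$, and $crt(P)=(0:1:1),(1:0:1),(1:1:0)$ if $M(P)=(0,\infty,-\infty),(-\infty,0,\infty),(\infty,-\infty,0)$ respectively. $M$ and $crt$ determine each other. (symmetry)-condition: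 the closure of $\mathrm{Im}(crt)$ in $\mathbb{R}P^2$ is contained in $\overline\Delta$. Strong Möbius structure: a Möbius structure satisfying the (corner)-condition: there are open neighbourhoods of $(1:0:0),(0:1:0),(0:0:1)$ in $\mathbb{R}P^2$ not meeting $\mathrm{Im}(crt)$. (The (symmetry)-condition implies the (corner)-condition.) Möbius topology. For a non-degenerate triple $A=(\omega,\alpha,\beta)$ put $\rho_A(x,x)=0$ and, for $x\ne y$, $\rho_A(x,y)=e^{a(\alpha,x,\omega,\beta)+a(\alpha,\omega,y,\beta)-a(\alpha,x,y,\beta)}$ if $x\neq\beta,\ y\neq\alpha$, and $\rho_A(x,y)=e^{b(\alpha,x,y,\beta)-b(\alpha,x,\omega,\beta)-b(\alpha,\omega,y,\beta)}$ if $x\neq\alpha,\ y\neq\beta$ (the formulas agree where both apply; $e^\infty=\infty$). The Möbius topology $\mathcal{T}_M$ has as subbasis all sets $\{x\in Z\mid\rho_A(x,y)<r\}$, over all non-degenerate $A=(\omega,\alpha,\beta)$, $r>0$, $y\in Z\setminus\{\omega\}$. Quasi-metrics. A $K$-quasi-metric ($K\ge 1$) is a symmetric map $\rho:Z\times Z\to[0,\infty)$ with $\rho(z,z')=0$ iff $z=z'$ and $\rho(x,z)\le K\max(\rho(x,y),\rho(y,z))$. An extended one takes values in $[0,\infty]$ and has exactly one point $\omega$ (point at infinity) with $\rho(x,\omega)=\infty$ for $x\ne\omega$, $\rho(\omega,\omega)=0$, and is a $K$-quasi-metric on $Z\setminus\{\omega\}$. It induces $M$ if $crt(z_1,z_2,z_3,z_4)=(\rho(z_1,z_2)\rho(z_3,z_4):\rho(z_1,z_3)\rho(z_2,z_4):\rho(z_1,z_4)\rho(z_2,z_3))$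 on $\mathcal{A}$, where infinite distances cancel each other (e.g. $crt(z_1,z_2,z_3,\omega)=(\rho(z_1,z_2):\rho(z_1,z_3):\rho(z_2,z_3))$ and $crt(z_1,z_2,\omega,\omega)=(0:1:1)$). Every strong Möbius structure is induced by a quasi-metric. Cauchy sequences and completeness. Let $(Z,M)$ be a strong Möbius space and $\rho$ a possibly extended quasi-metric inducing $M$. A good pair (with respect to $\rho$) for a sequence $(x_n)$ is a pair $y\neq z$ in $Z$, neither being the point at infinity of $\rho$ (if any), such that neither $\rho(x_n,y)$ nor $\rho(x_n,z)$ converges to $0$. $(x_n)$ is a Cauchy sequence if for one (and hence all) good pairs $c(x_n,x_m,y,z)\to-\infty$ as $n,m\to\infty$ (in particular the quadruple is admissible for all large $n,m$); the choice of $\rho$ is immaterial, and ''one'' means for some such $\rho$ and some good pair. $(Z,M)$ is complete if every Cauchy sequence converges in $\mathcal{T}_M$. Maps. A Möbius embedding $i:(Z,M)\to(Z',M')$ is an injective map with $M'(i(w),i(x),i(y),i(z))=M(w,x,y,z)$ for all admissible quadruples; a Möbius equivalence is a bijective such map. *)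

(* Defs.v *)
From HB Require Import structures.
From mathcomp Require Import all_boot all_order all_algebra all_fingroup.

Set Implicit Arguments.
Unset Strict Implicit.
Unset Printing Implicit Defensive.

Section Tuples.
Variables (T : Type) (n : nat).

Definition admissible (P : n.-tuple T) : Prop :=
  forall i j k : 'I_n, i != j -> j != k -> i != k ->
    ~ (tnth P i = tnth P j /\ tnth P j = tnth P k).

Definition nondegenerate (P : n.-tuple T) : Prop := injective (tnth P).

Definition permute (s : 'S_n) (P : n.-tuple T) : n.-tuple T :=
  [tuple tnth P (s i) | i < n].

End Tuples.

Section Pairings.
Local Open Scope nat_scope.
Local Open Scope set_scope.

(* The positions 1, 2, 3, 4 are the ordinals 0, 1, 2, 3. *)
Definition pairing (i : 'I_3) : {set {set 'I_4}} :=
  let p a b c d : {set {set 'I_4}} :=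
    [set [set inord a; inord b]; [set inord c; inord d]] in
  tnth [tuple p 0 1 2 3; p 0 2 3 1; p 0 3 1 2] i.

Definition phi (s : 'S_4) : 'S_3 :=
  odflt 1%g [pick t : 'S_3 |
    [forall i, (fun A : {set 'I_4} => s @: A) @: pairing i == pairing (t i)]].

Let o (k : nat) : 'I_4 := inord k.

Let oE (k l : nat) : k < 4 -> l < 4 -> (o k == o l) = (k == l).
Proof. by move=> k4 l4; rewrite -val_eqE /= !inordK. Qed.

Let edge (i : 'I_3) : {set 'I_4} := [set o 0; o i.+1].

Let pairingE (i : 'I_3) : pairing i = [set edge i; ~: edge i].
Proof.
suff opp a b c d : [set o a; o b; o c; o d] = setT -> uniq [:: o a; o b; o c; o d] ->
    [set o c; o d] = ~: [set o a; o b].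
  have T : [set o 0; o 1; o 2; o 3] = setT.
    apply/setP => -[[|[|[|[|]]]]//= x4]; rewrite !inE -!val_eqE /= !inordK//.
  by case: i => [[|[|[|]]]//= i3]; rewrite /pairing (tnth_nth set0) /=;
    congr [set _; _]; apply: opp; rewrite /= ?inE ?oE// -T;
    apply/setP => x; rewrite !inE; do 4 case: eqP.
move=> /setP T; rewrite /= !inE !negb_or => /and4P[/and3P[_ ac ad] /andP[bc bd] cd _].
apply/setP => x; have := T x; rewrite !inE -orbA.
have [->|xc] := eqVneq x (o c); first by rewrite eq_sym (negPf ac) eq_sym (negPf bc).
have [->|xd] := eqVneq x (o d); first by rewrite eq_sym (negPf ad) eq_sym (negPf bd).
by rewrite !orbF => ->.
Qed.

Let edge_inj : injective edge.
Proof.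
have lt4 (k : 'I_3) : k.+1 < 4 := ltn_ord k.
move=> i j /setP/(_ (o i.+1)); rewrite !inE eqxx orbT !oE//= => /esym/eqP[].
exact: val_inj.
Qed.

Let pairing_inj : injective pairing.
Proof.
move=> i j /setP/(_ (edge i)); rewrite !pairingE !inE eqxx /=.
case/esym/orP => /eqP; first exact: edge_inj.
by move=> /setP/(_ (o 0)); rewrite !inE eqxx.
Qed.

Let pairing_image (s : 'S_4) (i : 'I_3) :
  exists j, (fun A : {set 'I_4} => s @: A) @: pairing i = pairing j.
Proof.
have sC (A : {set 'I_4}) : s @: (~: A) = ~: (s @: A).
  by apply/setP => x; rewrite -(permKV s x) inE !mem_imset ?inE//; exact: perm_inj.
rewrite pairingE imsetU1 imset_set1 sC.
have [B [-> B0 cB]] : exists B : {set 'I_4},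
    [/\ [set s @: edge i; ~: (s @: edge i)] = [set B; ~: B], o 0 \in B & #|B| = 2].
  have c2 : #|s @: edge i| = 2.
    by rewrite (card_imset _ (@perm_inj _ s)) cards2 oE// ltnS ltn_ord.
  have [h|h] := boolP (o 0 \in s @: edge i); first by exists (s @: edge i).
  exists (~: (s @: edge i)); split; [by rewrite setCK setUC|by rewrite inE|].
  by apply/eqP; rewrite -(eqn_add2l 2) -{1}c2 cardsC card_ord.
have /cards1P[k Bk] : #|B :\ o 0| == 1.
  by rewrite -(eqn_add2l 1) -{1}[1]/(true : nat) -B0 -cardsD1 cB.
have k0 : k != o 0 by have /setP/(_ k) := Bk; rewrite !inE eqxx => /andP[].
have {}BE : B = [set o 0; k] by rewrite -(setD1K B0) Bk.
have k_gt0 : 0 < k.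
  rewrite lt0n; apply: contraNneq k0 => k0.
  by apply/eqP/val_inj; rewrite /= inordK.
have lk : k.-1 < 3 by rewrite -ltnS prednK.
exists (Ordinal lk); rewrite pairingE BE /edge /=.
suff <- : k = o k.-1.+1 by [].
by apply/val_inj; rewrite /= prednK// inordK.
Qed.

Lemma phiP (s : 'S_4) (i : 'I_3) :
  (fun A : {set 'I_4} => s @: A) @: pairing i = pairing (phi s i).
Proof.
rewrite /phi; case: pickP => [t /forallP/(_ i)/eqP //|no].
have [f fE] := fin_all_exists (pairing_image s).
have f_inj : injective f.
  move=> j k fjk; apply/pairing_inj/(imset_inj (imset_inj (@perm_inj _ s))).
  by rewrite !fE fjk.
by have /negP[] := no (perm f_inj); apply/forallP => j; rewrite permE -fE.
Qed.

End Pairings.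

From mathcomp Require Import all_classical all_reals all_analysis.

Import Order.TTheory GRing.Theory Num.Theory.
Import numFieldNormedType.Exports.

Local Open Scope classical_set_scope.
Local Open Scope ring_scope.

Section ProjectivePlane.
Local Open Scope quotient_scope.
Variable R : realType.

Definition punctured : set 'rV[R]_3 := [set v | v != 0].

Definition collinear (u v : punctured) : bool :=
  `[< exists k : R, \val v = k *: \val u >].

Lemma collinear_equiv : equiv_class_of collinear.
Proof.
have nz (u : punctured) : \val u != 0 by have := set_valP u.
have sym u v : collinear u v -> collinear v u.
  move=> /asboolP[k vE]; apply/asboolP; exists k^-1.
  have k0 : k != 0.
    by apply/eqP => k0; have := nz v; rewrite vE k0 scale0r eqxx.
  by rewrite vE scalerA mulVf// scale1r.
split.
- by move=> u; apply/asboolP; exists 1; rewrite scale1r.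
- by move=> u v; apply/idP/idP; exact: sym.
- move=> v u w /asboolP[k vE] /asboolP[l wE]; apply/asboolP.
  by exists (l * k); rewrite wE vE scalerA.
Qed.

Canonical collinear_equiv_rel := EquivRelPack collinear_equiv.

Definition RP2 : topologicalType :=
  quotient_topology {eq_quot collinear_equiv_rel}.

Lemma ones_punctured : const_mx 1 \in punctured.
Proof.
apply/mem_set/eqP => /matrixP /(_ 0 0); rewrite !mxE; exact/eqP/oner_neq0.
Qed.

(* The point (x : y : z); (1 : 1 : 1) as a dummy value when x = y = z = 0. *)
Definition homog (x y z : R) : RP2 :=
  \pi_{eq_quot collinear_equiv_rel}
    (insubd (exist (fun v => v \in punctured) _ ones_punctured : punctured)
            (\row_i tnth [tuple x; y; z] i)).

Definition Delta_bar : set RP2 :=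
  [set homog abc.1.1 abc.1.2 abc.2 | abc in
     [set abc : R * R * R | [/\ 0 < abc.1.1, 0 < abc.1.2 & 0 < abc.2]]] `|`
  [set p | [\/ p = homog 0 1 1, p = homog 1 0 1 | p = homog 1 1 0]].

End ProjectivePlane.

Section Moebius.
Variable R : realType.
Local Open Scope ereal_scope.

Notation triple := (3.-tuple (\bar R)).

Definition fst3 (u : triple) : \bar R := tnth u (@Ordinal 3 0 isT).
Definition snd3 (u : triple) : \bar R := tnth u (@Ordinal 3 1 isT).
Definition thd3 (u : triple) : \bar R := tnth u (@Ordinal 3 2 isT).

Definition corner1 : triple := [tuple 0; +oo; -oo].
Definition corner2 : triple := [tuple -oo; 0; +oo].
Definition corner3 : triple := [tuple +oo; -oo; 0].

Definition L4 : set triple :=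
  [set u | exists x y z : R,
    u = [tuple x%:E; y%:E; z%:E] /\ (x + y + z = 0)%R].

Definition L4_bar : set triple :=
  L4 `|` [set u | [\/ u = corner1, u = corner2 | u = corner3]].

Definition signed (s : 'S_4) (u : triple) : triple :=
  if odd_perm s then map_tuple -%E u else u.

(* u + v - w is free of +oo - oo. *)
Definition add_sub_def (u v w : \bar R) : Prop :=
  [/\ u +? v, u +? - w & v +? - w].

(* A map on the set of admissible quadruples is represented by a total
   function on quadruples; its values at the other ones are never used. *)
Definition is_moebius (Z : Type) (M : 4.-tuple Z -> triple) : Prop :=
  [/\ exists x y z : Z, [/\ x <> y, y <> z & x <> z],
      forall P, admissible P -> L4_bar (M P),
      forall P (s : 'S_4), admissible P ->
        M (permute s P) = signed s (permute (phi s) (M P)),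
      forall P, admissible P -> (L4 (M P) <-> nondegenerate P) &
      (forall x y z, admissible [tuple x; x; y; z] ->
        M [tuple x; x; y; z] = corner1) /\
      forall x y w al be, admissible [tuple x; y; w; al; be] ->
        nondegenerate [tuple w; al; be] ->
        let u1 := M [tuple al; x; w; be] in
        let u2 := M [tuple al; w; y; be] in
        let u3 := M [tuple al; x; y; be] in
        [/\ al <> x -> x <> be -> al <> y -> y <> be ->
              [/\ add_sub_def (fst3 u1) (fst3 u2) (fst3 u3),
                  add_sub_def (snd3 u1) (snd3 u2) (snd3 u3),
                  add_sub_def (thd3 u1) (thd3 u2) (thd3 u3) &
                  exists l : \bar R,
                    [/\ fst3 u1 + fst3 u2 - fst3 u3 = l,
                        snd3 u1 + snd3 u2 - snd3 u3 = - l &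
                        thd3 u1 + thd3 u2 - thd3 u3 = 0]],
            x <> be -> y <> al -> add_sub_def (fst3 u1) (fst3 u2) (fst3 u3) &
            x <> al -> y <> be -> add_sub_def (snd3 u1) (snd3 u2) (snd3 u3)]].

Definition crt_of_triple (u : triple) : RP2 R :=
  if u == corner1 then homog 0%R 1%R 1%R
  else if u == corner2 then homog 1%R 0%R 1%R
  else if u == corner3 then homog 1%R 1%R 0%R
  else let a := fine (fst3 u) in
       let b := fine (snd3 u) in
       let c := fine (thd3 u) in
       (homog (expR ((c - b) / 3)) (expR ((a - c) / 3)) (expR ((b - a) / 3)))%R.

Definition crt (Z : Type) (M : 4.-tuple Z -> triple) (P : 4.-tuple Z) : RP2 R :=
  crt_of_triple (M P).

Definition im_crt (Z : Type) (M : 4.-tuple Z -> triple) : set (RP2 R) :=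
  [set crt M P | P in @admissible Z 4].

Definition symmetry_condition (Z : Type) (M : 4.-tuple Z -> triple) : Prop :=
  closure (im_crt M) `<=` @Delta_bar R.

Definition corner_condition (Z : Type) (M : 4.-tuple Z -> triple) : Prop :=
  forall p : RP2 R,
    [\/ p = homog 1 0 0, p = homog 0 1 0 | p = homog 0 0 1]%R ->
    exists U : set (RP2 R), [/\ open U, U p & U `&` im_crt M = set0].

Definition is_strong_moebius (Z : Type) (M : 4.-tuple Z -> triple) : Prop :=
  is_moebius M /\ corner_condition M.

(* For a non-degenerate triple (w, al, be) and x <> y, the failure of the
   second test implies x <> al and y <> be. *)
Definition moebius_rho (Z : Type) (M : 4.-tuple Z -> triple) (w al be x y : Z)
    : \bar R :=
  let u1 := M [tuple al; x; w; be] in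
  let u2 := M [tuple al; w; y; be] in
  let u3 := M [tuple al; x; y; be] in
  if `[< x = y >] then 0
  else if `[< x <> be /\ y <> al >]
  then expeR (fst3 u1 + fst3 u2 - fst3 u3)
  else expeR (snd3 u3 - snd3 u1 - snd3 u2).

Definition moebius_subbasis (Z : Type) (M : 4.-tuple Z -> triple)
    : set (set Z) :=
  [set B | exists w al be y (r : R),
    [/\ nondegenerate [tuple w; al; be], (0 < r)%R, y <> w &
        B = [set x | moebius_rho M w al be x y < r%:E]]].

Definition moebius_topology (Z : Type) (M : 4.-tuple Z -> triple) : Type := Z.

End Moebius.

HB.instance Definition _ (R : realType) (Z : Type)
    (M : 4.-tuple Z -> 3.-tuple (\bar R)) :=
  gen_eqMixin (moebius_topology M).
HB.instance Definition _ (R : realType) (Z : Type)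
    (M : 4.-tuple Z -> 3.-tuple (\bar R)) :=
  gen_choiceMixin (moebius_topology M).
HB.instance Definition _ (R : realType) (Z : Type)
    (M : 4.-tuple Z -> 3.-tuple (\bar R)) :=
  @isSubBaseTopological.Build (moebius_topology M)
    (set (moebius_topology M)) (moebius_subbasis M) id.

Section Completeness.
Variables (R : realType) (Z : Type).
Local Open Scope ereal_scope.

Definition quasi_metric_on (D : set Z) (K : R) (rho : Z -> Z -> \bar R) : Prop :=
  [/\ (1 <= K)%R,
      forall x y, D x -> D y -> rho x y \is a fin_num /\ 0 <= rho x y,
      forall x y, D x -> D y -> rho x y = rho y x,
      forall x y, D x -> D y -> (rho x y = 0 <-> x = y) &
      forall x y z, D x -> D y -> D z ->
        rho x z <= K%:E * maxe (rho x y) (rho y z)].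

Definition quasi_metric (K : R) (rho : Z -> Z -> \bar R) : Prop :=
  quasi_metric_on setT K rho.

Definition point_at_infinity (rho : Z -> Z -> \bar R) (w : Z) : Prop :=
  (forall x, x <> w -> rho x w = +oo) /\ rho w w = 0.

Definition extended_quasi_metric (K : R) (rho : Z -> Z -> \bar R) : Prop :=
  (forall x y, rho x y = rho y x) /\
  exists w, [/\ point_at_infinity rho w,
                forall w', point_at_infinity rho w' -> w' = w &
                quasi_metric_on (~` [set w]) K rho].

Definition possibly_extended_quasi_metric (rho : Z -> Z -> \bar R) : Prop :=
  exists K : R, quasi_metric K rho \/ extended_quasi_metric K rho.

(* Infinite distances cancel.  In an admissible quadruple where the point at
   infinity occurs once, each of the three products of opposite distances has
   exactly one infinite factor; where it occurs twice, one of the products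
   contains rho w w = 0, hence vanishes, and the other two have two infinite
   factors each.  Cancelling thus amounts to replacing +oo by 1. *)
Definition cancel_dist (rho : Z -> Z -> \bar R) (x y : Z) : R :=
  if rho x y == +oo then 1%R else fine (rho x y).

Definition induces (rho : Z -> Z -> \bar R)
    (M : 4.-tuple Z -> 3.-tuple (\bar R)) : Prop :=
  forall z1 z2 z3 z4, admissible [tuple z1; z2; z3; z4] ->
    crt M [tuple z1; z2; z3; z4] =
    (homog (cancel_dist rho z1 z2 * cancel_dist rho z3 z4)
           (cancel_dist rho z1 z3 * cancel_dist rho z2 z4)
           (cancel_dist rho z1 z4 * cancel_dist rho z2 z3))%R.

Definition good_pair (rho : Z -> Z -> \bar R) (x : nat -> Z) (y z : Z) : Prop :=
  [/\ y <> z, ~ point_at_infinity rho y, ~ point_at_infinity rho z,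
      ~ (rho (x n) y @[n --> \oo] --> 0) &
      ~ (rho (x n) z @[n --> \oo] --> 0)].

Variable M : 4.-tuple Z -> 3.-tuple (\bar R).

Definition moebius_cauchy (x : nat -> Z) : Prop :=
  exists rho y z,
    [/\ possibly_extended_quasi_metric rho, induces rho M,
        good_pair rho x y z,
        \forall nm \near filter_prod \oo \oo,
          admissible [tuple x nm.1; x nm.2; y; z] &
        thd3 (M [tuple x nm.1; x nm.2; y; z])
          @[nm --> filter_prod \oo \oo] --> -oo].

Definition moebius_complete : Prop :=
  forall x : nat -> Z, moebius_cauchy x ->
    exists l : moebius_topology M,
      (x : nat -> moebius_topology M) @ \oo --> l.

End Completeness.

Section Maps.
Variables (R : realType) (Z Z' : Type).
Variables (M : 4.-tuple Z -> 3.-tuple (\bar R)).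
Variables (M' : 4.-tuple Z' -> 3.-tuple (\bar R)).

Definition moebius_embedding (i : Z -> Z') : Prop :=
  injective i /\ forall P, admissible P -> M' (map_tuple i P) = M P.

Definition moebius_equivalence (i : Z -> Z') : Prop :=
  bijective i /\ moebius_embedding i.

Definition moebius_dense (A : set Z) : Prop :=
  dense (A : set (moebius_topology M)).

End Maps.

(* Main.v *)
From mathcomp Require Import all_boot all_order all_algebra all_fingroup.
From mathcomp Require Import all_classical all_reals all_analysis.
From mathcomp Require Import ring lra.
Require Import Defs.

(** Call gauge a symmetric function [d : Z -> Z -> R] with nonnegative values
    which vanishes exactly on the diagonal.  A gauge defines a Moebius
    structure, whose three components are the logarithms of the quotients of
    the products of opposite distances ([moebius_of_is_moebius]).  Conversely
    every Moebius structure is defined by a gauge: the cocycle axiom and the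
    symmetries allow to write one down explicitly from the choice of three
    distinct points ([canonical_gauge_moebius]), so that this gauge is natural
    for Moebius embeddings ([canonical_gauge_map]).  Multiplying [d x y] by
    [f x * f y] does not change the structure, and one may divide by the
    heights [max (d x p) (d x q)], where [p <> q] are fixed: in the normalised
    gauge so obtained, every point is at distance 1 from one of [p], [q] and at
    distance at most 1 from the other one.

    Everything is now expressed by a normalised gauge [d].  The corner
    condition is the Ptolemy inequality up to a factor [K]
    ([corner_quasi_ptolemaic], [quasi_ptolemaic_corner]), and this makes [d] a
    bounded [K]-quasi-metric.  Convergence in the Moebius topology is the
    convergence of the distances to all points ([moebius_cvg_dist]), and a
    sequence [u] is Cauchy if and only if [d (u n) (u m)] tends to 0
    ([moebius_cauchy_dist], [dist_cauchy_moebius]).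

    The symmetry condition says, by compactness of an interval of the
    projective plane, that if one of the three products of opposite distances
    is small, then the other two almost agree ([symmetry_balanced]).  For a
    quadruple [(x, x', y, s)], with [s] a base point at distance 1 from [x],
    this bounds [d x y - d x' y] uniformly in [y] in terms of [d x x']
    ([balanced_uniform]).  Hence the functions [d x], with the uniform
    distance, form a metric space with the same Cauchy sequences as [d].  The
    completion consists of the uniform limits of these functions; [d] extends
    to it by continuity, and remains a normalised gauge satisfying the Ptolemy
    inequality, which yields a complete strong Moebius space in which [Z] is
    dense.

    Finally, let [i] embed [Z] into a complete strong Moebius space [Z'] with
    dense image, and let [d'] be the gauge of [Z'] normalised at the images of
    the points chosen in [Z]; it restricts to [d].  Then
    [z' |-> (y |-> d' z' (i y))] is an isometry of [Z'] onto the completion: it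
    takes values in the completion by density, and it is onto because [Z'] is
    complete ([completion_universal]).  Its inverse is the required
    equivalence [f].  It is unique, since the naturality of the gauge expresses
    [d' (f h) (i y)] in terms of the completion alone, and these numbers
    determine the point [f h]. *)

Set Implicit Arguments.
Unset Strict Implicit.
Unset Printing Implicit Defensive.
Import Order.TTheory GRing.Theory Num.Theory.
Import numFieldNormedType.Exports.
Local Open Scope ring_scope.

(** * Quadruples, pairings and permutations *)

Section PairingTheory.
Local Open Scope set_scope.

(** The positions in a quadruple, and the indices of the pairings. *)
Definition pos0 : 'I_4 := @Ordinal 4 0 isT.
Definition pos1 : 'I_4 := @Ordinal 4 1 isT.
Definition pos2 : 'I_4 := @Ordinal 4 2 isT.
Definition pos3 : 'I_4 := @Ordinal 4 3 isT.
Definition e0 : 'I_3 := @Ordinal 3 0 isT.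
Definition e1 : 'I_3 := @Ordinal 3 1 isT.
Definition e2 : 'I_3 := @Ordinal 3 2 isT.

(** The index of the pairing that contains the edge joining two positions
    (a dummy value when the positions coincide). *)
Definition edge_index (a b : 'I_4) : 'I_3 :=
  match (a : nat), (b : nat) with
  | 0, 1 | 1, 0 | 2, 3 | 3, 2 => e0
  | 0, 2 | 2, 0 | 1, 3 | 3, 1 => e1
  | _, _ => e2
  end%N.

Lemma ord4_cases (P : 'I_4 -> Prop) :
  P pos0 -> P pos1 -> P pos2 -> P pos3 -> forall i, P i.
Proof.
move=> p0 p1 p2 p3 [[|[|[|[|//]]]] ilt];
  [move: p0|move: p1|move: p2|move: p3]; congr (P _); exact/val_inj.
Qed.

Lemma ord3_cases (P : 'I_3 -> Prop) :
  P e0 -> P e1 -> P e2 -> forall i, P i.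
Proof.
move=> p0 p1 p2 [[|[|[|//]]] ilt];
  [move: p0|move: p1|move: p2]; congr (P _); exact/val_inj.
Qed.

Lemma set2_eq (T : finType) (a b c d : T) : a != b -> [set a; b] = [set c; d] ->
  (a == c) && (b == d) || (a == d) && (b == c).
Proof.
move=> ab /finset.setP E.
have := E a; have := E b; rewrite !inE !eqxx orbT /=.
case/esym/orP => /eqP bE /esym/orP[] /eqP aE;
  by move: ab; rewrite aE bE !eqxx ?orbT.
Qed.

Lemma inord_pos : (inord 0 = pos0) * (inord 1 = pos1) *
  (inord 2 = pos2) * (inord 3 = pos3).
Proof. by split; [split; [split|]|]; apply/val_inj; rewrite /= inordK. Qed.

Lemma pairing_edge (a b : 'I_4) : a != b ->
  [set a; b] \in pairing (edge_index a b).
Proof.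
by elim/ord4_cases: a; elim/ord4_cases: b => //= _;
  rewrite /pairing (tnth_nth finset.set0) /= !inE !inord_pos ?eqxx ?orbT//;
  rewrite finset.setUC eqxx ?orbT.
Qed.

Lemma edge_pairing (k : 'I_3) (a b : 'I_4) : a != b ->
  [set a; b] \in pairing k -> edge_index a b = k.
Proof.
move=> ab; elim/ord3_cases: k;
  rewrite /pairing (tnth_nth finset.set0) /= !inE !inord_pos;
  by case/orP => /eqP/(set2_eq ab)/orP[] /andP[/eqP-> /eqP->].
Qed.

(** A permutation of the positions moves the pairing of an edge to the pairing
    of the image of that edge. *)
Lemma phi_edge (s : 'S_4) (a b : 'I_4) : a != b ->
  phi s (edge_index a b) = edge_index (s a) (s b).
Proof.
move=> ab; apply/esym/edge_pairing; first by rewrite (inj_eq perm_inj).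
rewrite -phiP; apply/imsetP; exists [set a; b]; first exact: pairing_edge.
by rewrite imsetU1 imset_set1.
Qed.

Lemma phiM (s t : 'S_4) : phi (s * t)%g = (phi s * phi t)%g.
Proof.
apply/permP => k; rewrite permM.
have {k} [a [b [ab ->]]] : exists a b, a != b /\ k = edge_index a b.
  by elim/ord3_cases: k; exists pos0; [exists pos1|exists pos2|exists pos3].
by rewrite !phi_edge ?(inj_eq perm_inj)// !permM.
Qed.

Lemma phi1 : phi 1 = 1%g.
Proof. by apply: (mulgI (phi 1)); rewrite -phiM !mulg1. Qed.

Lemma permuteM (T : Type) n (s t : 'S_n) (P : n.-tuple T) :
  permute (s * t)%g P = permute s (permute t P).
Proof. by apply: eq_from_tnth => i; rewrite !tnth_mktuple permM. Qed.

Lemma permute1 (T : Type) n (P : n.-tuple T) : permute 1%g P = P.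
Proof. by apply: eq_from_tnth => i; rewrite !tnth_mktuple perm1. Qed.

Lemma admissible_permute (T : Type) n (s : 'S_n) (P : n.-tuple T) :
  admissible P -> admissible (permute s P).
Proof.
move=> aP i j k ij jk ik; rewrite !tnth_mktuple.
by apply: aP; rewrite (inj_eq perm_inj).
Qed.

Lemma tuple4E (T : Type) (P : 4.-tuple T) :
  P = [tuple tnth P pos0; tnth P pos1; tnth P pos2; tnth P pos3].
Proof.
by apply: eq_from_tnth; elim/ord4_cases; rewrite (tnth_nth (tnth P pos0)).
Qed.

Lemma tuple4_ind (T : Type) (Q : 4.-tuple T -> Prop) :
  (forall x y z t, Q [tuple x; y; z; t]) -> forall P, Q P.
Proof. by move=> QT P; rewrite [P]tuple4E; exact: QT. Qed.

Lemma tuple3E (T : Type) (P : 3.-tuple T) :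
  P = [tuple tnth P e0; tnth P e1; tnth P e2].
Proof.
by apply: eq_from_tnth; elim/ord3_cases; rewrite (tnth_nth (tnth P e0)).
Qed.

Section Tuples4.
Variable T : Type.
Implicit Types x y z t : T.

Lemma tnth4E x y z t : (tnth [tuple x; y; z; t] pos0 = x) *
  (tnth [tuple x; y; z; t] pos1 = y) *
  (tnth [tuple x; y; z; t] pos2 = z) * (tnth [tuple x; y; z; t] pos3 = t).
Proof. by []. Qed.

Lemma tnth3E x y z : (tnth [tuple x; y; z] e0 = x) *
  (tnth [tuple x; y; z] e1 = y) * (tnth [tuple x; y; z] e2 = z).
Proof. by []. Qed.

Lemma nondegenerate4 x y z t : nondegenerate [tuple x; y; z; t] <->
  [/\ x <> y, x <> z, x <> t & [/\ y <> z, y <> t & z <> t]].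
Proof.
split=> [inj|[xy xz xt [yz yt zt]]].
- by split; [| | |split] => E;
    [have := inj pos0 pos1 E|have := inj pos0 pos2 E|have := inj pos0 pos3 E
    |have := inj pos1 pos2 E|have := inj pos1 pos3 E|have := inj pos2 pos3 E].
- by elim/ord4_cases; elim/ord4_cases; rewrite !tnth4E // => /esym.
Qed.

Lemma nondegenerate3 x y z : nondegenerate [tuple x; y; z] <->
  [/\ x <> y, x <> z & y <> z].
Proof.
split=> [inj|[xy xz yz]].
- by split => E; [have := inj e0 e1 E|have := inj e0 e2 E|have := inj e1 e2 E].
- by elim/ord3_cases; elim/ord3_cases; rewrite !tnth3E // => /esym.
Qed.

Lemma admissible4 x y z t : admissible [tuple x; y; z; t] <->
  [/\ ~ (x = y /\ y = z), ~ (x = y /\ y = t), ~ (x = z /\ z = t) &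
      ~ (y = z /\ z = t)].
Proof.
split=> [a|[xyz xyt xzt yzt]].
- by split; [apply: (a pos0 pos1 pos2)|apply: (a pos0 pos1 pos3)
    |apply: (a pos0 pos2 pos3)|apply: (a pos1 pos2 pos3)].
- by elim/ord4_cases; elim/ord4_cases; elim/ord4_cases => // _ _ _;
    rewrite !tnth4E => -[E F]; subst;
    first [by apply: xyz|by apply: xyt|by apply: xzt|by apply: yzt].
Qed.

Lemma admissible5 x y w a b : nondegenerate [tuple w; a; b] ->
  a <> x -> b <> x -> a <> y -> b <> y -> ~ (x = y /\ y = w) ->
  admissible [tuple x; y; w; a; b].
Proof.
move/nondegenerate3 => [wa wb ab] ax bx ay by' xyw.
case=> [[|[|[|[|[|//]]]]] i5]; case=> [[|[|[|[|[|//]]]]] j5];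
case=> [[|[|[|[|[|//]]]]] k5] // _ _ _;
  rewrite !(tnth_nth x) /= => -[E F]; subst => //; by apply: xyw.
Qed.

Lemma admissible5_012 x y w a b : admissible [tuple x; y; w; a; b] ->
  ~ (x = y /\ y = w).
Proof.
by move=> /(_ (@Ordinal 5 0 isT) (@Ordinal 5 1 isT) (@Ordinal 5 2 isT));
  rewrite !(tnth_nth x); apply.
Qed.

End Tuples4.

Lemma nondegenerate_admissible (T : Type) n (P : n.-tuple T) :
  nondegenerate P -> admissible P.
Proof. by move=> nP i j k ij _ _ [/nP/eqP]; rewrite (negPf ij). Qed.

Lemma map_tuple4 (T U : Type) (f : T -> U) x y z t :
  map_tuple f [tuple x; y; z; t] = [tuple f x; f y; f z; f t].
Proof. exact/val_inj. Qed.

End PairingTheory.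

(** * The Moebius structure of a gauge *)

Section Gauges.
Variables (R : realType) (Z : Type).
Implicit Types (d : Z -> Z -> R) (x y z t : Z) (P : 4.-tuple Z).

(** A distance function without any triangle inequality.  Its values are
    finite: a distance to a point at infinity can be taken to be 1. *)
Definition gauge d : Prop :=
  [/\ forall x, d x x = 0, forall x y, d x y = d y x &
      forall x y, x <> y -> 0 < d x y].

Lemma gauge_ge0 d x y : gauge d -> 0 <= d x y.
Proof.
by move=> [d0 _ dp]; have [->|/dp/ltW//] := pselect (x = y); rewrite d0.
Qed.

Lemma gauge_eq0 d x y : gauge d -> d x y = 0 -> x = y.
Proof.
by move=> [_ _ dp] dxy; apply: contrapT => /dp; rewrite dxy ltxx.
Qed.

(** The product of the distances along the two edges of the pairing of
    index [k]. *)
Definition opp_prod d P (k : 'I_3) : R :=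
  let p := tnth P in
  tnth [tuple d (p pos0) (p pos1) * d (p pos2) (p pos3);
              d (p pos0) (p pos2) * d (p pos1) (p pos3);
              d (p pos0) (p pos3) * d (p pos1) (p pos2)] k.

(** Its logarithm, equal to [-oo] when the product vanishes. *)
Definition log_opp d P k : \bar R := lne (opp_prod d P k)%:E.

(** The Moebius structure of a gauge.  The formula also yields the three
    corners: if one product vanishes, then the other two are equal. *)
Definition moebius_of d P : 3.-tuple (\bar R) :=
  let l := log_opp d P in ([tuple l e1 - l e2; l e2 - l e0; l e0 - l e1])%E.

Lemma opp_prodE d x y z t : let P := [tuple x; y; z; t] in
  (opp_prod d P e0 = d x y * d z t) * (opp_prod d P e1 = d x z * d y t) *
  (opp_prod d P e2 = d x t * d y z).
Proof. by move=> P; split; [split|]. Qed.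

Lemma opp_prod_edge d P a b i j : gauge d -> uniq [:: a; b; i; j] ->
  d (tnth P a) (tnth P b) * d (tnth P i) (tnth P j) =
  opp_prod d P (edge_index a b).
Proof.
move=> [_ ds _].
elim/ord4_cases: a; elim/ord4_cases: b => //;
elim/ord4_cases: i => //; elim/ord4_cases: j => // _;
rewrite /opp_prod [RHS](tnth_nth 0) /=;
rewrite ?(ds _ (tnth P pos0)) ?(ds (tnth P pos3));
rewrite ?(ds (tnth P pos2) (tnth P pos1)) //;
by rewrite mulrC.
Qed.

Lemma opp_prod_permute d P (s : 'S_4) k : gauge d ->
  opp_prod d (permute s P) k = opp_prod d P (phi s k).
Proof.
move=> gd.
have {k} [a [b [i [j [u ->]]]]] :
    exists a b i j, uniq [:: a; b; i; j] /\ k = edge_index a b.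
  exists pos0; elim/ord3_cases: k.
  - by exists pos1, pos2, pos3.
  - by exists pos2, pos1, pos3.
  - by exists pos3, pos1, pos2.
rewrite -(opp_prod_edge _ gd u) !tnth_mktuple phi_edge.
  by apply: opp_prod_edge => //; move: u; rewrite /= !inE !(inj_eq perm_inj).
by case/andP: u; rewrite !inE !negb_or => /and3P[].
Qed.

Lemma log_opp_permute d P (s : 'S_4) k : gauge d ->
  log_opp d (permute s P) k = log_opp d P (phi s k).
Proof. by move=> gd; rewrite /log_opp opp_prod_permute. Qed.

Lemma opp_prod_ge0 d P k : gauge d -> 0 <= opp_prod d P k.
Proof.
by move=> gd; elim/ord3_cases: k; rewrite mulr_ge0// gauge_ge0.
Qed.

Lemma opp_prod_eq0 d x y z t : gauge d -> let P := [tuple x; y; z; t] in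
  [/\ opp_prod d P e0 = 0 -> x = y \/ z = t,
      opp_prod d P e1 = 0 -> x = z \/ y = t &
      opp_prod d P e2 = 0 -> x = t \/ y = z].
Proof.
by move=> gd; split; rewrite !opp_prodE => /eqP;
  rewrite mulf_eq0 => /orP[/eqP/(gauge_eq0 gd)|/eqP/(gauge_eq0 gd)]; tauto.
Qed.

(** At most one of the three products vanishes on an admissible quadruple, so
    that no difference of infinities occurs in [moebius_of]. *)
Lemma opp_prod_admissible d P j k : gauge d -> admissible P -> j != k ->
  opp_prod d P j = 0 -> 0 < opp_prod d P k.
Proof.
move=> gd aP jk Xj; rewrite lt_neqAle opp_prod_ge0// andbT eq_sym.
apply/eqP => Xk; move: P j k jk Xj Xk aP.
apply: tuple4_ind => x y z t j k jk.
have [h0 h1 h2] := opp_prod_eq0 x y z t gd.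
by move: jk; elim/ord3_cases: j; elim/ord3_cases: k => // _;
  first [move/h0|move/h1|move/h2] => E1;
  first [move/h0|move/h1|move/h2] => E2 /admissible4 [];
  case: E1 => ?; case: E2 => ?; subst; tauto.
Qed.

Lemma log_opp_fin d P k : 0 < opp_prod d P k ->
  log_opp d P k = (ln (opp_prod d P k))%:E.
Proof. by move=> X; rewrite /log_opp lne_EFin. Qed.

Lemma log_opp0 d P k : opp_prod d P k = 0 -> log_opp d P k = -oo%E.
Proof. by rewrite /log_opp => ->; rewrite /lne lexx. Qed.

Lemma log_oppB d P j k : gauge d -> admissible P -> j != k ->
  (log_opp d P j - log_opp d P k = - (log_opp d P k - log_opp d P j))%E.
Proof.
move=> gd aP jk.
have [Xj|Xj] := eqVneq (opp_prod d P j) 0.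
  have Xk := opp_prod_admissible gd aP jk Xj.
  by rewrite (log_opp0 Xj) (log_opp_fin Xk).
have {}Xj : 0 < opp_prod d P j by rewrite lt_neqAle eq_sym Xj opp_prod_ge0.
rewrite (log_opp_fin Xj).
have [Xk|Xk] := eqVneq (opp_prod d P k) 0; first by rewrite (log_opp0 Xk).
have {}Xk : 0 < opp_prod d P k by rewrite lt_neqAle eq_sym Xk opp_prod_ge0.
by rewrite (log_opp_fin Xk) -!EFinB -EFinN opprB.
Qed.

Lemma signedM (s t : 'S_4) (u : 3.-tuple (\bar R)) :
  signed (s * t)%g u = signed s (signed t u).
Proof.
rewrite /signed odd_permM; case: (odd_perm s); case: (odd_perm t) => //=.
by apply: eq_from_tnth => i; rewrite !tnth_map oppeK.
Qed.

Lemma signed_permute (s : 'S_4) (t : 'S_3) (u : 3.-tuple (\bar R)) :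
  signed s (permute t u) = permute t (signed s u).
Proof.
rewrite /signed; case: (odd_perm s) => //.
by apply: eq_from_tnth => i; rewrite tnth_map !tnth_mktuple tnth_map.
Qed.

Lemma phi_tperm (i j : 'I_4) k : i != j ->
  phi (tperm i j) k =
  edge_index (tperm i j pos0) (tperm i j (lift ord0 k)).
Proof.
move=> ij; rewrite -phi_edge//; congr (phi _ _).
by elim/ord3_cases: k; apply/val_inj.
Qed.

(** Both sides are compatible with products of permutations, so that it is
    enough to check the transpositions. *)
Lemma moebius_of_permute d P (s : 'S_4) : gauge d -> admissible P ->
  moebius_of d (permute s P) = signed s (permute (phi s) (moebius_of d P)).
Proof.
move=> gd; have [ts -> /allP tsP] := prod_tpermP s.
elim: ts tsP P => [|[i j] ts IH] tsP P aP.
  by rewrite !big_nil phi1 !permute1 /signed odd_perm1.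
rewrite !big_cons permuteM phiM permuteM signedM /=.
set s' := (\prod_(t <- ts) tperm t.1 t.2)%g in IH *.
have ij : i != j by have := tsP _ (mem_head _ _).
rewrite signed_permute -IH//; last first.
  by move=> u uts; apply: tsP; rewrite inE uts orbT.
have {aP IH} := admissible_permute (s := s') aP.
move: (permute s' P) => {s' tsP}P aP.
rewrite {1}/signed odd_tperm ij.
have LB := log_oppB gd aP.
apply: eq_from_tnth => k.
rewrite tnth_map tnth_mktuple.
rewrite /moebius_of !log_opp_permute// !(phi_tperm _ ij).
move: ij; elim/ord4_cases: i; elim/ord4_cases: j => // _;
  elim/ord3_cases: k; rewrite !permE /= !(tnth_nth 0%E) /=.
all: exact: LB.
Qed.

Lemma opp_prod_eq d x y z t : gauge d -> let P := [tuple x; y; z; t] in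
  [/\ opp_prod d P e0 = 0 -> opp_prod d P e1 = opp_prod d P e2,
      opp_prod d P e1 = 0 -> opp_prod d P e2 = opp_prod d P e0 &
      opp_prod d P e2 = 0 -> opp_prod d P e0 = opp_prod d P e1].
Proof.
move=> gd P; have [h0 h1 h2] := opp_prod_eq0 x y z t gd.
have [_ ds _] := gd.
split=> [/h0|/h1|/h2] [] E; rewrite !opp_prodE E //.
- by rewrite mulrC.
- by rewrite mulrC (ds y z).
- by rewrite (ds t z).
- by rewrite (ds t y) (ds t z) mulrC.
Qed.

Lemma moebius_of_fin d P : (forall k, 0 < opp_prod d P k) ->
  let l k := ln (opp_prod d P k) in
  moebius_of d P = [tuple (l e1 - l e2)%:E; (l e2 - l e0)%:E; (l e0 - l e1)%:E].
Proof. by move=> X0 l; rewrite /moebius_of !log_opp_fin. Qed.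

Lemma moebius_of_corner d P : gauge d -> admissible P ->
  [/\ opp_prod d P e0 = 0 -> moebius_of d P = corner1 R,
      opp_prod d P e1 = 0 -> moebius_of d P = corner2 R &
      opp_prod d P e2 = 0 -> moebius_of d P = corner3 R].
Proof.
move=> gd; move: P; apply: tuple4_ind => x y z t aP.
have [h0 h1 h2] := opp_prod_eq x y z t gd.
have pos := opp_prod_admissible gd aP.
have lE j k :
    opp_prod d [tuple x; y; z; t] j = opp_prod d [tuple x; y; z; t] k ->
    log_opp d [tuple x; y; z; t] j = log_opp d [tuple x; y; z; t] k.
  by rewrite /log_opp => ->.
split=> X0; rewrite /moebius_of.
- rewrite (lE _ _ (h0 X0)) (log_opp0 X0) (log_opp_fin (pos e0 e2 isT X0)).
  by rewrite -EFinB subrr.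
- rewrite (lE _ _ (h1 X0)) (log_opp0 X0) (log_opp_fin (pos e1 e0 isT X0)).
  by rewrite -EFinB subrr.
- rewrite (lE _ _ (h2 X0)) (log_opp0 X0) (log_opp_fin (pos e2 e1 isT X0)).
  by rewrite -EFinB subrr.
Qed.

Lemma nondegenerate_opp_prod d P : gauge d ->
  nondegenerate P <-> forall k, 0 < opp_prod d P k.
Proof.
move=> gd; have [d0 _ dp] := gd; move: P; apply: tuple4_ind => x y z t.
rewrite nondegenerate4; split=> [[xy xz xt [yz yt zt]]|X].
  by elim/ord3_cases; rewrite opp_prodE mulr_gt0 ?dp.
have := X e0; have := X e1; have := X e2; rewrite !opp_prodE => X2 X1 X0.
by split; [| | |split] => E; subst; move: X0 X1 X2;
  rewrite !d0 ?(mul0r, mulr0) ltxx.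
Qed.

Lemma corner_notin_L4 :
  ~ L4 (corner1 R) /\ ~ L4 (corner2 R) /\ ~ L4 (corner3 R).
Proof.
split; [|split] => -[a [b [c [E _]]]].
- by have := congr1 (fun u => tnth u e1) E.
- by have := congr1 (fun u => tnth u e0) E.
- by have := congr1 (fun u => tnth u e0) E.
Qed.

Lemma moebius_of_L4 d P : gauge d -> nondegenerate P -> L4 (moebius_of d P).
Proof.
move=> gd /(nondegenerate_opp_prod _ gd) X; rewrite moebius_of_fin//.
by do 3 eexists; split; first reflexivity; ring.
Qed.

Lemma opp_prod_cases d P : gauge d ->
  [\/ nondegenerate P, opp_prod d P e0 = 0, opp_prod d P e1 = 0
    | opp_prod d P e2 = 0].
Proof.
move=> gd; have X k := opp_prod_ge0 P k gd.
have [E0|X0] := eqVneq (opp_prod d P e0) 0; first by constructor 2.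
have [E1|X1] := eqVneq (opp_prod d P e1) 0; first by constructor 3.
have [E2|X2] := eqVneq (opp_prod d P e2) 0; first by constructor 4.
constructor 1; apply/(nondegenerate_opp_prod _ gd).
by elim/ord3_cases; rewrite lt_neqAle eq_sym X ?X0 ?X1 ?X2.
Qed.

Lemma moebius_of_L4_bar d P : gauge d -> admissible P ->
  L4_bar (moebius_of d P).
Proof.
move=> gd aP; have [c1 c2 c3] := moebius_of_corner gd aP.
have [nP|/c1->|/c2->|/c3->] := opp_prod_cases P gd; last first.
- by right; constructor 3.
- by right; constructor 2.
- by right; constructor 1.
- by left; exact: moebius_of_L4.
Qed.

Lemma moebius_of_L4P d P : gauge d -> admissible P ->
  L4 (moebius_of d P) <-> nondegenerate P.
Proof.
move=> gd aP; have [c1 c2 c3] := moebius_of_corner gd aP.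
have [n1 [n2 n3]] := corner_notin_L4.
have [nP|X|X|X] := opp_prod_cases P gd.
- by split=> // _; exact: moebius_of_L4.
- split=> [|/(nondegenerate_opp_prod _ gd)/(_ e0)]; last by rewrite X ltxx.
  by rewrite c1.
- split=> [|/(nondegenerate_opp_prod _ gd)/(_ e1)]; last by rewrite X ltxx.
  by rewrite c2.
- split=> [|/(nondegenerate_opp_prod _ gd)/(_ e2)]; last by rewrite X ltxx.
  by rewrite c3.
Qed.

(** The logarithm of the distance, equal to [-oo] on the diagonal. *)
Definition log_dist d x y : \bar R := lne (d x y)%:E.

Lemma log_dist_refl d x : gauge d -> log_dist d x x = -oo%E.
Proof. by move=> [d0 _ _]; rewrite /log_dist d0 /= lexx. Qed.

Lemma log_dist_neq d x y : gauge d -> x <> y ->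
  log_dist d x y = (ln (d x y))%:E.
Proof. by move=> [_ _ dp] /dp dxy; rewrite /log_dist lne_EFin. Qed.

Lemma lne_mul (u v : R) : 0 <= u -> 0 <= v ->
  (lne (u * v)%:E = lne u%:E + lne v%:E)%E.
Proof.
rewrite !le_eqVlt => /predU1P[<-|u0] /predU1P[<-|v0].
- by rewrite mul0r /= lexx.
- by rewrite mul0r /= lexx.
- by rewrite mulr0 /= lexx addeNy.
- by rewrite !lne_EFin ?mulr_gt0// lnM.
Qed.

Lemma moebius_ofE d x y z t : gauge d -> let l := log_dist d in
  moebius_of d [tuple x; y; z; t] =
  [tuple l x z + l y t - (l x t + l y z); l x t + l y z - (l x y + l z t);
         l x y + l z t - (l x z + l y t)]%E.
Proof.
move=> gd l; rewrite /moebius_of /log_opp !opp_prodE !lne_mul ?gauge_ge0//.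
Qed.

Lemma moebius_of_is_moebius d : gauge d ->
  (exists x y z : Z, [/\ x <> y, y <> z & x <> z]) -> is_moebius (moebius_of d).
Proof.
move=> gd Z3; split=> //.
- by move=> P; exact: moebius_of_L4_bar.
- by move=> P s; exact: moebius_of_permute.
- by move=> P; exact: moebius_of_L4P.
split=> [x y z aP|].
  have [c1 _ _] := moebius_of_corner gd aP; apply: c1.
  by have [d0 _ _] := gd; rewrite opp_prodE d0 mul0r.
move=> x y w a b adm /nondegenerate3[wa wb ab] u1 u2 u3.
have xyw := admissible5_012 adm.
have fin v z : v <> z -> exists r, log_dist d v z = r%:E.
  by move=> vz; eexists; exact: log_dist_neq.
have cases v z : v = z \/ exists r, log_dist d v z = r%:E.
  by have [?|/fin ?] := pselect (v = z); [left|right].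
have lr z := log_dist_refl z gd.
rewrite /u1 /u2 /u3 !moebius_ofE// /fst3 /snd3 /thd3 !(tnth_nth 0%E) /=.
have [aw ->] := fin a w (nesym wa).
have [wb' ->] := fin w b wb.
have [ab' ->] := fin a b ab.
(* At most one of the three distances between x, y and w vanishes. *)
have three : [\/
    exists p q r, [/\ log_dist d x w = p%:E, log_dist d w y = q%:E &
      log_dist d x y = r%:E],
    exists q r, [/\ log_dist d x w = -oo%E, log_dist d w y = q%:E &
      log_dist d x y = r%:E],
    exists p r, [/\ log_dist d x w = p%:E, log_dist d w y = -oo%E &
      log_dist d x y = r%:E]
  | exists p q, [/\ log_dist d x w = p%:E, log_dist d w y = q%:E &
      log_dist d x y = -oo%E]].
  have [xw|[p pE]] := cases x w; have [wy|[q qE]] := cases w y;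
    have [xy|[r rE]] := cases x y; subst; try by exfalso; apply: xyw.
  - by constructor 2; exists q, r; rewrite lr.
  - by constructor 3; exists p, r; rewrite lr.
  - by constructor 4; exists p, q; rewrite lr.
  - by constructor 1; exists p, q, r.
split=> [ax xb ay yb|xb ya|xa yb].
- have [ax' ->] := fin a x ax; have [xb' ->] := fin x b xb.
  have [ay' ->] := fin a y ay; have [yb' ->] := fin y b yb.
  case: three => [[p [q [r [-> -> ->]]]]|[q [r [-> -> ->]]]
    |[p [r [-> -> ->]]]|[p [q [-> -> ->]]]]; split=> //; eexists;
  split; first [reflexivity|
    by rewrite /= -?EFinD -?EFinN -?EFinD -?EFinN -?EFinD;
       congr (_%:E); ring|idtac].
- have [xb' ->] := fin x b xb; have [ay' ->] := fin a y (nesym ya).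
  by case: three => [[p [q [r [-> -> ->]]]]|[q [r [-> -> ->]]]
    |[p [r [-> -> ->]]]|[p [q [-> -> ->]]]]; split.
- have [ax' ->] := fin a x (nesym xa); have [yb' ->] := fin y b yb.
  by case: three => [[p [q [r [-> -> ->]]]]|[q [r [-> -> ->]]]
    |[p [r [-> -> ->]]]|[p [q [-> -> ->]]]]; split.
Qed.
End Gauges.

(** * Comparing two Moebius structures *)

Section Swaps.
Variables (R : realType) (Z : Type) (M : 4.-tuple Z -> 3.-tuple (\bar R)).
Hypothesis hM : is_moebius M.
Implicit Types x y z t : Z.

Lemma moebius_swap01 x y z t : admissible [tuple x; y; z; t] ->
  let u := M [tuple x; y; z; t] in
  M [tuple y; x; z; t] = ([tuple - fst3 u; - thd3 u; - snd3 u])%E.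
Proof.
move=> a u; have [_ _ hp _ _] := hM.
have -> : [tuple y; x; z; t] = permute (tperm pos0 pos1) [tuple x; y; z; t].
  by apply: eq_from_tnth; elim/ord4_cases; rewrite tnth_mktuple permE !tnth4E.
rewrite hp// /signed odd_tperm /=; apply: eq_from_tnth => k.
rewrite tnth_map tnth_mktuple phi_tperm//.
by elim/ord3_cases: k; rewrite !permE.
Qed.

Lemma moebius_swap12 x y z t : admissible [tuple x; y; z; t] ->
  let u := M [tuple x; y; z; t] in
  M [tuple x; z; y; t] = ([tuple - snd3 u; - fst3 u; - thd3 u])%E.
Proof.
move=> a u; have [_ _ hp _ _] := hM.
have -> : [tuple x; z; y; t] = permute (tperm pos1 pos2) [tuple x; y; z; t].
  by apply: eq_from_tnth; elim/ord4_cases; rewrite tnth_mktuple permE !tnth4E.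
rewrite hp// /signed odd_tperm /=; apply: eq_from_tnth => k.
rewrite tnth_map tnth_mktuple phi_tperm//.
by elim/ord3_cases: k; rewrite !permE.
Qed.

Lemma moebius_swap23 x y z t : admissible [tuple x; y; z; t] ->
  let u := M [tuple x; y; z; t] in
  M [tuple x; y; t; z] = ([tuple - fst3 u; - thd3 u; - snd3 u])%E.
Proof.
move=> a u; have [_ _ hp _ _] := hM.
have -> : [tuple x; y; t; z] = permute (tperm pos2 pos3) [tuple x; y; z; t].
  by apply: eq_from_tnth; elim/ord4_cases; rewrite tnth_mktuple permE !tnth4E.
rewrite hp// /signed odd_tperm /=; apply: eq_from_tnth => k.
rewrite tnth_map tnth_mktuple phi_tperm//.
by elim/ord3_cases: k; rewrite !permE.
Qed.

End Swaps.

Section Agreement.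
Variables (R : realType) (Z : Type) (M N : 4.-tuple Z -> 3.-tuple (\bar R)).
Hypotheses (hM : is_moebius M) (hN : is_moebius N).
Implicit Types x y z t : Z.

Let agree x y z t : Prop :=
  admissible [tuple x; y; z; t] -> M [tuple x; y; z; t] = N [tuple x; y; z; t].

Let adm01 x y z t : admissible [tuple x; y; z; t] ->
  admissible [tuple y; x; z; t].
Proof.
move=> /admissible4[? ? ? ?]; apply/admissible4.
by split=> -[? ?]; subst; tauto.
Qed.
Let adm12 x y z t : admissible [tuple x; y; z; t] ->
  admissible [tuple x; z; y; t].
Proof.
move=> /admissible4[? ? ? ?]; apply/admissible4.
by split=> -[? ?]; subst; tauto.
Qed.
Let adm23 x y z t : admissible [tuple x; y; z; t] ->
  admissible [tuple x; y; t; z].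
Proof.
move=> /admissible4[? ? ? ?]; apply/admissible4.
by split=> -[? ?]; subst; tauto.
Qed.

Let agree01 x y z t : agree x y z t -> agree y x z t.
Proof.
by move=> E /adm01 a; rewrite (moebius_swap01 hM a) (moebius_swap01 hN a) E.
Qed.
Let agree12 x y z t : agree x y z t -> agree x z y t.
Proof.
by move=> E /adm12 a; rewrite (moebius_swap12 hM a) (moebius_swap12 hN a) E.
Qed.
Let agree23 x y z t : agree x y z t -> agree x y t z.
Proof.
by move=> E /adm23 a; rewrite (moebius_swap23 hM a) (moebius_swap23 hN a) E.
Qed.

Let agree_eq01 x z t : agree x x z t.
Proof.
move=> a; have [_ _ _ _ [hMc _]] := hM; have [_ _ _ _ [hNc _]] := hN.
by rewrite hMc// hNc.
Qed.
Let agree_eq02 x y t : agree x y x t.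
Proof. exact/agree12/agree_eq01. Qed.
Let agree_eq03 x y z : agree x y z x.
Proof. exact/agree23/agree_eq02. Qed.

(** On degenerate quadruples the values are forced, and on the other ones each
    component is the third component of a permuted quadruple. *)
Lemma moebius_agree :
  (forall P, nondegenerate P -> thd3 (M P) = thd3 (N P)) ->
  forall P, admissible P -> M P = N P.
Proof.
move=> E; apply: tuple4_ind => x y z t.
have [->|xy] := pselect (x = y); first exact: agree_eq01.
have [->|xz] := pselect (x = z); first exact: agree_eq02.
have [->|xt] := pselect (x = t); first exact: agree_eq03.
have [->|yz] := pselect (y = z); first exact/agree01/agree_eq02.
have [->|yt] := pselect (y = t); first exact/agree01/agree_eq03.
have [->|zt] := pselect (z = t); first exact/agree12/agree01/agree_eq03.
move=> aP.
have nP : nondegenerate [tuple x; y; z; t] by apply/nondegenerate4.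
have nP12 : nondegenerate [tuple x; z; y; t].
  by apply/nondegenerate4; do !split=> //; exact: nesym.
have nP23 : nondegenerate [tuple x; y; t; z].
  by apply/nondegenerate4; do !split=> //; exact: nesym.
have nP1 : nondegenerate [tuple x; z; t; y].
  by apply/nondegenerate4; do !split=> //; exact: nesym.
have a12 := nondegenerate_admissible nP12.
have a23 := nondegenerate_admissible nP23.
have := E _ nP; have := E _ nP1; have := E _ nP23.
rewrite (moebius_swap23 hM a12) (moebius_swap23 hN a12).
rewrite (moebius_swap12 hM aP) (moebius_swap12 hN aP).
rewrite (moebius_swap23 hM aP) (moebius_swap23 hN aP).
rewrite /thd3 /snd3 /fst3 !(tnth_nth 0%E) /= => /oppe_inj Eb.
move=> /oppe_inj/oppe_inj Ea Ec.
rewrite [LHS]tuple3E [RHS]tuple3E; congr [tuple _; _; _];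
  by rewrite ?(tnth_nth 0%E).
Qed.

End Agreement.

(** * The canonical gauge of a Moebius structure *)

Section CanonicalGauge.
Variables (R : realType) (Z : Type) (M : 4.-tuple Z -> 3.-tuple (\bar R)).
Implicit Types x y z t w a b : Z.

(** On nondegenerate quadruples, the logarithm of
    [d x y * d z t / (d x z * d y t)] for any gauge [d] defining [M]. *)
Definition log_cr x y z t : R := fine (thd3 (M [tuple x; y; z; t])).

(** If [x], [y] and [z] differ from [w], and [x] from [y] and [z], this is the
    logarithm of [d x y / d x z] for any gauge [d] defining [M] whose distances
    to [w] all equal 1. *)
Definition log_ratio w x y z : R :=
  if `[< y = z >] then 0 else log_cr x y z w.

(** The logarithm of [d x y] for distinct points [x] and [y] other than [w], if
    moreover [d a b = 1]: compare [d x y] with [d x a], then [d a x] with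
    [d a b]. *)
Definition canonical_log w a b x y : R :=
  if `[< x = a >] then log_ratio w a y b
  else log_ratio w a x b + log_ratio w x y a.

(** The gauge defining [M] for which [a] and [b] are at distance 1 and all
    points other than [w] are at distance 1 from [w]. *)
Definition canonical_gauge w a b x y : R :=
  if `[< x = y >] then 0
  else if `[< x = w \/ y = w >] then 1
  else expR (canonical_log w a b x y).

Hypothesis hM : is_moebius M.

Let M_real x y z t : nondegenerate [tuple x; y; z; t] -> exists p q r : R,
  M [tuple x; y; z; t] = [tuple p%:E; q%:E; r%:E] /\ p + q + r = 0.
Proof.
by move=> nP; have [_ _ _ hL _] := hM;
  have /(hL _ (nondegenerate_admissible nP)) := nP.
Qed.

Let nd01 x y z t : nondegenerate [tuple x; y; z; t] ->
  nondegenerate [tuple y; x; z; t].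
Proof.
by rewrite !nondegenerate4 => -[? ? ? [? ? ?]]; do !split=> //; exact: nesym.
Qed.
Let nd12 x y z t : nondegenerate [tuple x; y; z; t] ->
  nondegenerate [tuple x; z; y; t].
Proof.
by rewrite !nondegenerate4 => -[? ? ? [? ? ?]]; do !split=> //; exact: nesym.
Qed.
Let nd23 x y z t : nondegenerate [tuple x; y; z; t] ->
  nondegenerate [tuple x; y; t; z].
Proof.
by rewrite !nondegenerate4 => -[? ? ? [? ? ?]]; do !split=> //; exact: nesym.
Qed.

Let tupE : forall p q r : \bar R, (fst3 [tuple p; q; r] = p) *
  (snd3 [tuple p; q; r] = q) * (thd3 [tuple p; q; r] = r).
Proof. by []. Qed.

Let M01 x y z t p q r : nondegenerate [tuple x; y; z; t] ->
  M [tuple x; y; z; t] = [tuple p%:E; q%:E; r%:E] ->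
  M [tuple y; x; z; t] = [tuple (- p)%:E; (- r)%:E; (- q)%:E].
Proof. by move=> /nondegenerate_admissible/(moebius_swap01 hM) -> ->. Qed.
Let M12 x y z t p q r : nondegenerate [tuple x; y; z; t] ->
  M [tuple x; y; z; t] = [tuple p%:E; q%:E; r%:E] ->
  M [tuple x; z; y; t] = [tuple (- q)%:E; (- p)%:E; (- r)%:E].
Proof. by move=> /nondegenerate_admissible/(moebius_swap12 hM) -> ->. Qed.
Let M23 x y z t p q r : nondegenerate [tuple x; y; z; t] ->
  M [tuple x; y; z; t] = [tuple p%:E; q%:E; r%:E] ->
  M [tuple x; y; t; z] = [tuple (- p)%:E; (- r)%:E; (- q)%:E].
Proof. by move=> /nondegenerate_admissible/(moebius_swap23 hM) -> ->. Qed.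

Let log_crP x y z t p q r : M [tuple x; y; z; t] = [tuple p; q; r] ->
  log_cr x y z t = fine r.
Proof. by rewrite /log_cr => ->. Qed.

Let log_cr12 x y z t : nondegenerate [tuple x; y; z; t] ->
  log_cr x z y t = - log_cr x y z t.
Proof.
move=> n0; have [p [q [r [E _]]]] := M_real n0.
by rewrite (log_crP E) (log_crP (M12 n0 E)).
Qed.

Let log_crC x y z t : nondegenerate [tuple x; y; z; t] ->
  log_cr y x t z = log_cr x y z t.
Proof.
move=> n0; have [p [q [r [E _]]]] := M_real n0.
have E1 := M01 n0 E; have E2 := M23 (nd01 n0) E1.
by rewrite (log_crP E) (log_crP E2) /= opprK.
Qed.

Let log_cr_rot x y z t : nondegenerate [tuple x; y; z; t] ->
  log_cr z t x y = log_cr x y z t.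
Proof.
move=> n0; have n1 := nd12 n0; have n2 := nd01 n1; have n3 := nd23 n2.
have [p [q [r [E0 _]]]] := M_real n0.
have E1 := M12 n0 E0; have E2 := M01 n1 E1; have E3 := M23 n2 E2.
by rewrite (log_crP E0) (log_crP (M12 n3 E3)) /= !opprK.
Qed.

Let log_cr_sum x y z t : nondegenerate [tuple x; y; z; t] ->
  log_cr x y z t + log_cr x z t y + log_cr x t y z = 0.
Proof.
move=> n0; have n1 := nd12 n0; have n2 := nd23 n1; have n3 := nd12 n2.
have [p [q [r [E0 pqr]]]] := M_real n0.
have E1 := M12 n0 E0; have E2 := M23 n1 E1; have E3 := M12 n2 E2.
by rewrite (log_crP E0) (log_crP E2) (log_crP (M23 n3 E3)) /= !opprK -pqr; ring.
Qed.

(* The third component of the fourth axiom. *)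
Let log_cr_cocycle x y w a b : x <> y -> x <> w -> y <> w ->
  nondegenerate [tuple a; x; w; b] -> nondegenerate [tuple a; w; y; b] ->
  log_cr a x w b + log_cr a w y b = log_cr a x y b.
Proof.
move=> xy xw yw n1 n2.
have /nondegenerate4[ax aw ab [_ xb wb]] := n1.
have /nondegenerate4[_ ay _ [_ _ yb]] := n2.
have n3 : nondegenerate [tuple a; x; y; b].
  by apply/nondegenerate4; do !split=> //; exact: nesym.
have [_ _ _ _ [_ h4]] := hM.
have nw : nondegenerate [tuple w; a; b].
  by apply/nondegenerate3; do !split=> //; exact: nesym.
have [] := h4 x y w a b _ nw.
  by apply: admissible5 => //; [exact: nesym|exact: nesym|case].
move=> /(_ ax xb ay yb)[_ _ _ [l [_ _ e]]] _ _.
have [p1 [q1 [r1 [E1 _]]]] := M_real n1.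
have [p2 [q2 [r2 [E2 _]]]] := M_real n2.
have [p3 [q3 [r3 [E3 _]]]] := M_real n3.
by move: e; rewrite /log_cr E1 E2 E3 !tupE => /(congr1 fine) /= /subr0_eq.
Qed.

Variables (w a b : Z).
Hypothesis wab : nondegenerate [tuple w; a; b].
Let T := log_ratio w.
Let l := canonical_log w a b.

Let TE x y z : y <> z -> T x y z = log_cr x y z w.
Proof. by move=> yz; rewrite /T /log_ratio asboolF. Qed.

Let T_refl x y : T x y y = 0.
Proof. by rewrite /T /log_ratio asboolT. Qed.

Let TC x y z : x <> w -> y <> w -> z <> w -> x <> y -> x <> z ->
  T x z y = - T x y z.
Proof.
move=> xw yw zw xy xz.
have [->|yz] := pselect (y = z); first by rewrite T_refl oppr0.
rewrite (TE _ yz) (TE _ (nesym yz)) log_cr12//; exact/nondegenerate4.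
Qed.

Let T_cocycle x y z t : x <> w -> y <> w -> z <> w -> t <> w ->
  x <> y -> x <> z -> x <> t -> T x y z + T x z t = T x y t.
Proof.
move=> xw yw zw tw xy xz xt.
have [->|yz] := pselect (y = z); first by rewrite T_refl add0r.
have [->|zt] := pselect (z = t); first by rewrite T_refl addr0.
have [<-|yt] := pselect (y = t).
  by rewrite (TC xw yw zw xy xz) T_refl subrr.
rewrite (TE _ yz) (TE _ zt) (TE _ yt) log_cr_cocycle//; first exact: nesym.
- by apply/nondegenerate4.
- by apply/nondegenerate4.
Qed.

Let T_sum x y z : x <> w -> y <> w -> z <> w -> x <> y -> x <> z -> y <> z ->
  T x y z + T y z x + T z x y = 0.
Proof.
move=> xw yw zw xy xz yz; have n0 : nondegenerate [tuple x; y; z; w].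
  by apply/nondegenerate4.
rewrite (TE _ yz) (TE _ (nesym xz)) (TE _ xy).
have n1 : nondegenerate [tuple x; w; y; z].
  by apply/nondegenerate4; do !split=> //; exact: nesym.
have n2 : nondegenerate [tuple x; z; w; y].
  by apply/nondegenerate4; do !split=> //; exact: nesym.
by rewrite (log_cr_rot n1) (log_crC n2) -(log_cr_sum n0); ring.
Qed.

Let wa : w <> a. Proof. by have /nondegenerate3[] := wab. Qed.
Let wb : w <> b. Proof. by have /nondegenerate3[] := wab. Qed.
Let ab : a <> b. Proof. by have /nondegenerate3[] := wab. Qed.

Let l_a y : l a y = T a y b.
Proof. by rewrite /l /canonical_log asboolT. Qed.

Let l_notin x y : x <> a -> l x y = T a x b + T x y a.
Proof. by move=> xa; rewrite /l /canonical_log asboolF. Qed.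

Let l_sym x y : x <> y -> x <> w -> y <> w -> l x y = l y x.
Proof.
move=> xy xw yw.
have [xa|xa] := pselect (x = a).
  by subst x; rewrite l_a (l_notin _ (nesym xy)) T_refl addr0.
have [ya|ya] := pselect (y = a).
  by subst y; rewrite l_a l_notin ?T_refl ?addr0.
rewrite !l_notin//.
have S := T_sum xw yw (nesym wa) xy xa ya.
have C := T_cocycle (nesym wa) xw yw (nesym wb) (nesym xa) (nesym ya) ab.
have := TC yw xw (nesym wa) (nesym xy) ya.
by move=> E; lra.
Qed.

Let l_sub x y z : x <> w -> y <> w -> z <> w -> x <> y -> x <> z ->
  l x y - l x z = T x y z.
Proof.
move=> xw yw zw xy xz.
have [xa|xa] := pselect (x = a).
  subst x; rewrite !l_a.
  have := T_cocycle xw yw zw (nesym wb) xy xz ab.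
  by move=> E; lra.
rewrite !l_notin//.
have := T_cocycle xw yw zw (nesym wa) xy xz xa.
by move=> E; lra.
Qed.

Let d := canonical_gauge w a b.

Let d_w x : x <> w -> d x w = 1 /\ d w x = 1.
Proof.
move=> xw; rewrite /d /canonical_gauge (asboolF xw) (asboolF (nesym xw)).
by rewrite !asboolT//; [left|right].
Qed.

Let d_l x y : x <> y -> x <> w -> y <> w -> d x y = expR (l x y).
Proof.
by move=> xy xw yw; rewrite /d /canonical_gauge !asboolF// => -[].
Qed.

Lemma canonical_gauge_gauge : gauge d.
Proof.
split.
- by move=> x; rewrite /d /canonical_gauge asboolT.
- move=> x y; have [->//|xy] := pselect (x = y).
  have [xw|xw] := pselect (x = w).
    by subst x; have [-> ->] := d_w (nesym xy).
  have [->|yw] := pselect (y = w); first by have [-> ->] := d_w xw.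
  by rewrite (d_l xy xw yw) (d_l (nesym xy) yw xw) l_sym.
- move=> x y xy; rewrite /d /canonical_gauge asboolF//.
  by case: ifP => // _; exact: expR_gt0.
Qed.

Let ld x y : R := ln (d x y).

Let ld_w x : x <> w -> ld x w = 0 /\ ld w x = 0.
Proof. by rewrite /ld => /d_w[-> ->]; rewrite ln1. Qed.

Let ld_l x y : x <> y -> x <> w -> y <> w -> ld x y = l x y.
Proof. by rewrite /ld => xy xw yw; rewrite d_l// expRK. Qed.

Let log_cr_w x y z : nondegenerate [tuple x; y; z; w] ->
  log_cr x y z w = ld x y + ld z w - ld x z - ld y w.
Proof.
move=> /nondegenerate4[xy xz xw [yz yw zw]].
have [-> _] := ld_w zw; have [-> _] := ld_w yw.
by rewrite !ld_l// addr0 subr0 l_sub// TE.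
Qed.

(* The values on all quadruples are determined by those on the quadruples
   ending with [w]. *)
Let log_cr_from_w (f : Z -> Z -> R) : (forall u v, f u v = f v u) ->
  (forall x y z, nondegenerate [tuple x; y; z; w] ->
    log_cr x y z w = f x y + f z w - f x z - f y w) ->
  forall x y z t, nondegenerate [tuple x; y; z; t] ->
    log_cr x y z t = f x y + f z t - f x z - f y t.
Proof.
move=> fC fw x y z t nP.
have /nondegenerate4[xy xz xt [yz yt zt]] := nP.
have [tw|tw] := pselect (t = w); first by subst t; exact: fw.
have [zw|zw] := pselect (z = w).
  subst z; rewrite -log_crC// fw; last exact: nd23 (nd01 nP).
  by rewrite (fC y x) (fC t w) (fC y t) (fC x w); ring.
have [yw|yw] := pselect (y = w).
  subst y; rewrite -log_cr_rot// fw; last first.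
    by apply/nondegenerate4; do !split=> //; exact: nesym.
  by rewrite (fC z x) (fC t w); ring.
have [xw|xw] := pselect (x = w).
  subst x; rewrite -log_cr_rot// -log_crC; last first.
    by apply/nondegenerate4; do !split=> //; exact: nesym.
  rewrite fw; last first.
    by apply/nondegenerate4; do !split=> //; exact: nesym.
  by rewrite (fC t z) (fC y w) (fC t y) (fC z w); ring.
have n1 : nondegenerate [tuple y; x; w; z].
  by apply/nondegenerate4; do !split=> //; exact: nesym.
have n2 : nondegenerate [tuple y; w; t; z].
  by apply/nondegenerate4; do !split=> //; exact: nesym.
rewrite -log_crC// -(log_cr_cocycle xt xw tw n1 n2).
have n3 : nondegenerate [tuple x; y; z; w] by apply/nondegenerate4.
have n4 : nondegenerate [tuple t; z; y; w].
  by apply/nondegenerate4; do !split=> //; exact: nesym.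
rewrite (log_crC n3) -(log_cr_rot n2) !fw//.
by rewrite (fC t z) (fC t y); ring.
Qed.

Let log_crE x y z t : nondegenerate [tuple x; y; z; t] ->
  log_cr x y z t = ld x y + ld z t - ld x z - ld y t.
Proof.
have [_ ds _] := canonical_gauge_gauge.
by apply: log_cr_from_w; [move=> u v; rewrite /ld ds|exact: log_cr_w].
Qed.

(** Every Moebius structure is defined by a gauge. *)
Lemma canonical_gauge_moebius P : admissible P -> M P = moebius_of d P.
Proof.
have gd := canonical_gauge_gauge.
apply: moebius_agree => //.
  by apply: moebius_of_is_moebius => //; have [] := hM.
apply: tuple4_ind => x y z t nP.
have /nondegenerate4[xy xz xt [yz yt zt]] := nP.
have [p [q [r [E _]]]] := M_real nP.
have -> : thd3 (M [tuple x; y; z; t]) = r%:E by rewrite E.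
have := log_crE nP; rewrite (log_crP E) => /= ->.
rewrite moebius_ofE// /thd3 (tnth_nth 0%E) /= !log_dist_neq//.
rewrite /ld; move: (ln _) (ln _) (ln _) (ln _) => p1 p2 p3 p4.
by congr (_%:E); ring.
Qed.

End CanonicalGauge.

Local Open Scope classical_set_scope.

(** * Homogeneous coordinates in the projective plane *)

Section Homogeneous.
Local Open Scope quotient_scope.
Variable R : realType.
Implicit Types (x y z : R) (u v : @punctured R).

Let vec x y z : 'rV[R]_3 := \row_i tnth [tuple x; y; z] i.

(** The triples that are homogeneous coordinates of a point. *)
Definition nonzero3 x y z : Prop := ~ [/\ x = 0, y = 0 & z = 0].

Let vec_neq0 x y z : nonzero3 x y z -> vec x y z \in @punctured R.
Proof.
move=> n; apply/mem_set/eqP => /matrixP E; apply: n.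
by split; [have := E 0 e0|have := E 0 e1|have := E 0 e2]; rewrite !mxE.
Qed.

Let pt x y z (n : nonzero3 x y z) : @punctured R :=
  exist (fun v : 'rV[R]_3 => v \in @punctured R) (vec x y z) (vec_neq0 n).

Let homogE x y z (n : nonzero3 x y z) :
  homog x y z = \pi_{eq_quot (collinear_equiv_rel R)} (pt n).
Proof.
rewrite /homog; congr (\pi _); apply/val_inj.
by rewrite val_insubd /= vec_neq0.
Qed.

Lemma homog_scale k x y z : k != 0 -> nonzero3 x y z ->
  homog (k * x) (k * y) (k * z) = homog x y z.
Proof.
move=> k0 n; have n' : nonzero3 (k * x) (k * y) (k * z).
  move=> [/eqP + /eqP + /eqP]; rewrite !mulf_eq0 (negPf k0) /=.
  by move=> /eqP ? /eqP ? /eqP ?; exact: n.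
rewrite (homogE n) (homogE n'); apply/esym/eqmodP/asboolP; exists k.
by apply/rowP => i; rewrite !mxE; elim/ord3_cases: i.
Qed.

Lemma homog_eq x y z x' y' z' : nonzero3 x y z -> nonzero3 x' y' z' ->
  homog x y z = homog x' y' z' ->
  exists k, [/\ x' = k * x, y' = k * y & z' = k * z].
Proof.
move=> n n'; rewrite (homogE n) (homogE n') => /eqmodP/asboolP[k E].
by exists k; split; [have /matrixP/(_ 0 e0) := E|have /matrixP/(_ 0 e1) := E
  |have /matrixP/(_ 0 e2) := E]; rewrite !mxE.
Qed.

Let nonzero3_near x y z : nonzero3 x y z -> exists2 e, 0 < e &
  forall x' y' z', `|x' - x| < e -> `|y' - y| < e -> `|z' - z| < e ->
  nonzero3 x' y' z'.
Proof.
move=> n.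
have [x0|x0] := eqVneq x 0; last first.
  exists `|x|; rewrite ?normr_gt0// => ? ? ? H _ _ [E _ _].
  by move: H; rewrite E sub0r normrN ltxx.
have [y0|y0] := eqVneq y 0; last first.
  exists `|y|; rewrite ?normr_gt0// => ? ? ? _ H _ [_ E _].
  by move: H; rewrite E sub0r normrN ltxx.
have [z0|z0] := eqVneq z 0; last first.
  exists `|z|; rewrite ?normr_gt0// => ? ? ? _ _ H [_ _ E].
  by move: H; rewrite E sub0r normrN ltxx.
by exfalso; apply: n.
Qed.

(** Continuity of the map from nonzero triples to the projective plane. *)
Lemma open_homog (U : set (RP2 R)) x y z : open U -> nonzero3 x y z ->
  U (homog x y z) -> exists2 e, 0 < e & forall x' y' z',
    `|x' - x| < e -> `|y' - y| < e -> `|z' - z| < e -> U (homog x' y' z').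
Proof.
move=> [V oV VU] n; rewrite (homogE n) => Un.
have [e1 e1p n1] := nonzero3_near n.
have Vx : V (vec x y z).
  by have : (set_val @^-1` V) (pt n) by rewrite VU.
have /nbhs_ballP[e2 /= e2p e2V] : nbhs (vec x y z) V by apply: open_nbhs_nbhs.
exists (Num.min e1 e2); first by rewrite lt_min e1p.
move=> x' y' z'; rewrite !lt_min => /andP[a1 a2] /andP[b1 b2] /andP[c1 c2].
have n' := n1 _ _ _ a1 b1 c1; rewrite (homogE n').
suff : (set_val @^-1` V) (pt n') by rewrite VU.
apply: e2V; split=> // i j; rewrite !mxE.
by elim/ord3_cases: j; rewrite /ball /= distrC.
Qed.

(** The points whose coordinates other than the [i]-th are small compared with
    the [i]-th one. *)
Definition corner_nbhd (i : 'I_3) (r : R) : set (RP2 R) :=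
  [set p | exists x y z, let v := [tuple x; y; z] in
    [/\ nonzero3 x y z, p = homog x y z &
        forall j, j != i -> `|tnth v j| < r * `|tnth v i|]].

Let corner_nbhdE i r :
  \pi_{eq_quot (collinear_equiv_rel R)} @^-1` (corner_nbhd i r) =
  [set u : @punctured R | forall j, j != i -> `|val u 0 j| < r * `|val u 0 i|].
Proof.
apply/seteqP; split=> [u [x [y [z [n uE H]]]] j ji /=|u H /=].
  move: uE; rewrite (homogE n) => /esym/eqmodP/asboolP[k E].
  have kE j' : val u 0 j' = k * tnth [tuple x; y; z] j'.
    by move/matrixP/(_ 0 j') : E; rewrite !mxE.
  have k0 : 0 < `|k|.
    rewrite normr_gt0; apply/eqP => k0.
    by have /eqP[] := set_valP u; apply/rowP => j'; rewrite kE k0 mul0r mxE.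
  by rewrite !kE !normrM mulrCA ltr_pM2l// H.
have n : nonzero3 (val u 0 e0) (val u 0 e1) (val u 0 e2).
  move=> [E0 E1 E2]; have /eqP[] := set_valP u.
  by apply/rowP; elim/ord3_cases; rewrite mxE.
have uE j : tnth [tuple val u 0 e0; val u 0 e1; val u 0 e2] j = val u 0 j.
  by elim/ord3_cases: j.
exists (val u 0 e0), (val u 0 e1), (val u 0 e2); split=> //.
  rewrite (homogE n); congr (\pi _); apply/val_inj/rowP => j.
  by rewrite mxE uE.
by move=> j ji; rewrite !uE H.
Qed.

Lemma open_corner_nbhd i r : open (corner_nbhd i r).
Proof.
rewrite /open /= /quotient_open corner_nbhdE.
exists [set v : 'rV[R]_3 | forall j, j != i -> `|v 0 j| < r * `|v 0 i|] => //.
pose O j := [set v : 'rV[R]_3 | j != i -> `|v 0 j| < r * `|v 0 i|].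
have -> : [set v : 'rV[R]_3 | forall j, j != i -> `|v 0 j| < r * `|v 0 i|] =
    O e0 `&` O e1 `&` O e2.
  apply/seteqP; split=> v; first by move=> H; split; [split|]; exact: H.
  by move=> [[H0 H1] H2]; elim/ord3_cases.
suff oO j : open (O j) by apply: openI => //; exact: openI.
have [ji|ji] := boolP (j != i); last first.
  have -> : O j = setT by apply/seteqP; split=> // v _ /(negP ji).
  exact: openT.
have -> : O j =
    (fun v : 'rV[R]_3 => r * `|v 0 i| - `|v 0 j|) @^-1` [set x | 0 < x].
  by apply/seteqP; split=> v; rewrite /O /= subr_gt0 ji //; exact.
apply: open_comp; last exact: open_gt.
have C k : continuous (fun v : 'rV[R]_3 => `|v 0 k|).
  move=> v.
  apply: (@continuous_comp _ _ _ (fun v : 'rV[R]_3 => v 0 k) Num.norm).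
    exact: coord_continuous.
  exact: norm_continuous.
by move=> v _; exact: (cvgB (cvgM (cvg_cst r) (C i v)) (C j v)).
Qed.

End Homogeneous.

(** * The conditions on cross ratio triples in terms of gauges *)

Lemma inv_succ_lt (R : realType) (e : R) : 0 < e ->
  exists N, forall n, (N <= n)%N -> n.+1%:R^-1 < e.
Proof.
move=> /ltr_add_invr[N]; rewrite add0r => Ne; exists N => n Nn.
by apply: le_lt_trans Ne; rewrite lef_pV2 ?posrE// ler_nat.
Qed.

Section CrossRatioTriple.
Variables (R : realType) (Z : Type) (M : 4.-tuple Z -> 3.-tuple (\bar R)).
Variable d : Z -> Z -> R.
Hypotheses (gd : gauge d) (Md : forall P, admissible P -> M P = moebius_of d P).
Implicit Types (x y z t : Z) (P : 4.-tuple Z).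

Lemma opp_prod_nonzero3 P : admissible P ->
  nonzero3 (opp_prod d P e0) (opp_prod d P e1) (opp_prod d P e2).
Proof.
move=> aP [X0 X1 _].
have := opp_prod_admissible gd aP (j := e0) (k := e1) isT X0.
by rewrite X1 ltxx.
Qed.

(** The cross ratio triple consists of the products of opposite distances. *)
Lemma crtE P : admissible P ->
  crt M P = homog (opp_prod d P e0) (opp_prod d P e1) (opp_prod d P e2).
Proof.
move=> aP; rewrite /crt Md//.
have n3 := opp_prod_nonzero3 aP.
have [c1 c2 c3] := moebius_of_corner gd aP.
have pos := opp_prod_admissible gd aP.
have eqs : [/\ opp_prod d P e0 = 0 -> opp_prod d P e1 = opp_prod d P e2,
      opp_prod d P e1 = 0 -> opp_prod d P e2 = opp_prod d P e0 &
      opp_prod d P e2 = 0 -> opp_prod d P e0 = opp_prod d P e1].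
  by rewrite [P]tuple4E; exact: opp_prod_eq.
have [q0 q1 q2] := eqs.
have neq12 : corner2 R != corner1 R.
  by apply/eqP => /(congr1 (fun u => tnth u e0)).
have neq13 : corner3 R != corner1 R.
  by apply/eqP => /(congr1 (fun u => tnth u e0)).
have neq23 : corner3 R != corner2 R.
  by apply/eqP => /(congr1 (fun u => tnth u e0)).
have [nP|X|X|X] := opp_prod_cases P gd.
- have L := moebius_of_L4 gd nP.
  have [n1 [n2 n3']] := corner_notin_L4 R.
  rewrite /crt_of_triple ifF; last by apply/eqP => E; apply: n1; rewrite -E.
  rewrite ifF; last by apply/eqP => E; apply: n2; rewrite -E.
  rewrite ifF; last by apply/eqP => E; apply: n3'; rewrite -E.
  have X := (nondegenerate_opp_prod P gd).1 nP.
  rewrite moebius_of_fin// /fst3 /snd3 /thd3 !(tnth_nth 0%E) /=.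
  set l0 := ln _; set l1 := ln _; set l2 := ln _.
  (* The exponentials are the three products divided by their geometric mean. *)
  pose k := expR (- (l0 + l1 + l2) / 3).
  have kE j s : s = ln (opp_prod d P j) - (l0 + l1 + l2) / 3 ->
      expR s = k * opp_prod d P j.
    by move=> ->; rewrite expRD lnK ?posrE// mulrC /k mulNr.
  rewrite (kE e0); last by rewrite -/l0 -/l1 -/l2; field.
  rewrite (kE e1); last by rewrite -/l0 -/l1 -/l2; field.
  rewrite (kE e2); last by rewrite -/l0 -/l1 -/l2; field.
  by rewrite homog_scale// gt_eqF// expR_gt0.
- rewrite c1// /crt_of_triple eqxx X -q0//.
  have X1 := pos e0 e1 isT X.
  rewrite -[homog 0 (opp_prod d P e1) _](@homog_scale _ (opp_prod d P e1)^-1).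
  + by rewrite mulr0 mulVf// gt_eqF.
  + by rewrite invr_neq0// gt_eqF.
  + by move=> [_ E _]; rewrite E ltxx in X1.
- rewrite c2// /crt_of_triple (negPf neq12) eqxx X -q1//.
  have X1 := pos e1 e2 isT X.
  rewrite -[homog (opp_prod d P e2) _ _](@homog_scale _ (opp_prod d P e2)^-1).
  + by rewrite mulr0 mulVf// gt_eqF.
  + by rewrite invr_neq0// gt_eqF.
  + by move=> [_ _ E]; rewrite E ltxx in X1.
- rewrite c3// /crt_of_triple (negPf neq13) (negPf neq23) eqxx X -q2//.
  have X1 := pos e2 e0 isT X.
  rewrite -[homog (opp_prod d P e0) _ _](@homog_scale _ (opp_prod d P e0)^-1).
  + by rewrite mulr0 mulVf// gt_eqF.
  + by rewrite invr_neq0// gt_eqF.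
  + by move=> [E _ _]; rewrite E ltxx in X1.
Qed.

(** The Ptolemy inequality up to a factor; the maximum replaces the sum. *)
Definition quasi_ptolemaic (K : R) : Prop := forall x y z t,
  d x y * d z t <= K * Num.max (d x z * d y t) (d x t * d y z).

(** If one product of opposite distances is small, then the other two almost
    agree. *)
Definition balanced : Prop := forall e, 0 < e -> exists2 r, 0 < r &
  forall x y z t,
    d x y * d z t <= r * Num.max (d x z * d y t) (d x t * d y z) ->
    `|d x z * d y t - d x t * d y z| <=
      e * Num.max (d x z * d y t) (d x t * d y z).

Lemma opp_prod_gt0_admissible P k : 0 < opp_prod d P k -> admissible P.
Proof.
have [d0 _ _] := gd.
move: P; apply: tuple4_ind => x y z t X; apply/admissible4.
by split=> -[E F]; subst; move: X; elim/ord3_cases: k;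
  rewrite !opp_prodE !d0 ?(mul0r, mulr0) ltxx.
Qed.

Lemma corner_quasi_ptolemaic : corner_condition M ->
  exists2 K, 1 <= K & quasi_ptolemaic K.
Proof.
move=> cM; have [|U [oU U1 UM]] := cM (homog 1 0 0); first by constructor 1.
have n1 : @nonzero3 R 1 0 0 by move=> [/eqP]; rewrite oner_eq0.
have [e ep eU] := open_homog oU n1 U1.
exists (Num.max 1 e^-1); first by rewrite le_max lexx.
have [d0 ds dp] := gd.
move=> x y z t; set A := d x y * _; set B := d x z * _; set C := d x t * _.
have B0 : 0 <= B by rewrite mulr_ge0// gauge_ge0.
have C0 : 0 <= C by rewrite mulr_ge0// gauge_ge0.
have K0 : 0 <= Num.max 1 e^-1 by rewrite le_max ler01.
have [A0|A0] := leP A 0.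
  by apply: le_trans A0 _; rewrite mulr_ge0// le_max B0.
rewrite leNgt; apply/negP => H.
have aP : admissible [tuple x; y; z; t].
  by apply: (@opp_prod_gt0_admissible _ e0); rewrite opp_prodE.
have : (U `&` im_crt M) (homog A B C).
  split; last by exists [tuple x; y; z; t] => //; rewrite crtE.
  have nA : nonzero3 A B C by move=> [E _ _]; rewrite E ltxx in A0.
  rewrite -(homog_scale (k := A^-1)) ?invr_neq0 ?gt_eqF//.
  have H' X : X <= Num.max B C -> 0 <= X -> `|A^-1 * X - 0| < e.
    move=> XBC X0; rewrite subr0 ger0_norm; last first.
      by rewrite mulr_ge0// invr_ge0 ltW.
    rewrite mulrC ltr_pdivrMr//.
    have e1 : e * e^-1 = 1 by rewrite divff// gt_eqF.
    have H1 : e^-1 * X < A.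
      apply: le_lt_trans H; apply: ler_pM => //; first by rewrite invr_ge0 ltW.
      by rewrite le_max lexx orbT.
    by rewrite -[X]mul1r -e1 -mulrA ltr_pM2l.
  apply: eU.
  - by rewrite mulVf ?gt_eqF// subrr normr0.
  - by apply: H' => //; rewrite le_max lexx.
  - by apply: H' => //; rewrite le_max lexx orbT.
by rewrite UM.
Qed.

Lemma quasi_ptolemaic_corner K : 1 <= K -> quasi_ptolemaic K ->
  corner_condition M.
Proof.
move=> K1 pK; have K0 : 0 < K by apply: lt_le_trans K1.
have [d0 ds dp] := gd.
have nh i (a b c : R) : nonzero3 a b c ->
    tnth [tuple a; b; c] i = 1 ->
    (forall j, j != i -> tnth [tuple a; b; c] j = 0) ->
    exists U, [/\ open U, U (homog a b c) & U `&` im_crt M = set0].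
  move=> n ai aj; exists (corner_nbhd i K^-1); split.
  - exact: open_corner_nbhd.
  - exists a, b, c; split=> // j ji; rewrite aj// ai normr0 normr1 mulr1.
    by rewrite invr_gt0.
  apply/seteqP; split=> // p [Up [P aP pE]]; move: Up; rewrite -pE crtE//.
  move=> [x [y [z [n' E H]]]].
  have [k [k0 k1 k2]] := homog_eq n' (opp_prod_nonzero3 aP) (esym E).
  have kE j : opp_prod d P j = k * tnth [tuple x; y; z] j.
    by elim/ord3_cases: j.
  have kp : 0 < `|k|.
    rewrite normr_gt0; apply/eqP => kz; apply: (opp_prod_nonzero3 aP).
    by rewrite !kE kz !mul0r.
  have X0 j := opp_prod_ge0 P j gd.
  have {}H j : j != i -> opp_prod d P j < K^-1 * opp_prod d P i.
    move=> ji.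
    rewrite -[opp_prod d P j]ger0_norm// -[opp_prod d P i]ger0_norm//.
    by rewrite !kE !normrM mulrCA ltr_pM2l// H.
  suff [j1 [j2 [ij1 ij2 L]]] : exists j1 j2, [/\ j1 != i, j2 != i &
     opp_prod d P i <= K * Num.max (opp_prod d P j1) (opp_prod d P j2)].
    have : opp_prod d P i < K * (K^-1 * opp_prod d P i).
      by apply: (le_lt_trans L); rewrite ltr_pM2l// gt_max !H.
    by rewrite mulrA divff ?gt_eqF// mul1r ltxx.
  rewrite [P]tuple4E.
  set x1 := tnth _ pos0; set x2 := tnth _ pos1.
  set x3 := tnth _ pos2; set x4 := tnth _ pos3.
  elim/ord3_cases: i {ai aj H}.
  - by exists e1, e2; split=> //; exact: pK.
  - exists e0, e2; split=> //; rewrite !opp_prodE.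
    by have := pK x1 x3 x2 x4; rewrite (ds x3 x2).
  - exists e1, e0; split=> //; rewrite !opp_prodE.
    by have := pK x1 x4 x3 x2; rewrite (ds x3 x2) (ds x4 x2) (ds x4 x3).
have n1 : @nonzero3 R 1 0 0 by move=> [/eqP]; rewrite oner_eq0.
have n2 : @nonzero3 R 0 1 0 by move=> [_ /eqP]; rewrite oner_eq0.
have n3 : @nonzero3 R 0 0 1 by move=> [_ _ /eqP]; rewrite oner_eq0.
move=> p [] ->.
- by apply: (nh e0) => //; elim/ord3_cases.
- by apply: (nh e1) => //; elim/ord3_cases.
- by apply: (nh e2) => //; elim/ord3_cases.
Qed.

Let nonzero3_one (a b : R) : nonzero3 a b 1.
Proof. by move=> [_ _ /eqP]; rewrite oner_eq0. Qed.

Let homog0_Delta_bar (s : R) : @Delta_bar R (homog 0 s 1) -> s = 1.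
Proof.
case=> [[[[a b] c] /= [a0 b0 c0] E]|[] E].
- have n : nonzero3 a b c by move=> [E' _ _]; rewrite E' ltxx in a0.
  have [k [k0 _ _]] := homog_eq (@nonzero3_one 0 s) n (esym E).
  by rewrite k0 mulr0 ltxx in a0.
- have [k [_ k1 k2]] := homog_eq (@nonzero3_one 0 s) (@nonzero3_one 0 1) E.
  by move: k1; rewrite -[k]mulr1 -k2 mul1r.
- have [k [k1 _ _]] := homog_eq (@nonzero3_one 0 s) (@nonzero3_one 1 0) E.
  by move/eqP: k1; rewrite mulr0 oner_eq0.
- have n : @nonzero3 R 1 1 0 by move=> [/eqP]; rewrite oner_eq0.
  have [k [k1 _ _]] := homog_eq (@nonzero3_one 0 s) n E.
  by move/eqP: k1; rewrite mulr0 oner_eq0.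
Qed.

(** A sequence of quadruples violating [balanced] has, after normalisation, a
    cluster point [(0 : s : 1)] with [s < 1], which lies outside [Delta_bar]. *)
Lemma symmetry_balanced : symmetry_condition M -> balanced.
Proof.
move=> sM e ep; apply: contrapT => nr.
have [d0 ds dp] := gd.
have {nr} bad (n : nat) : exists P, [/\ 0 < opp_prod d P e2,
    opp_prod d P e0 <= n.+1%:R^-1 * opp_prod d P e2 &
    opp_prod d P e1 <= (1 - e) * opp_prod d P e2].
  apply: contrapT => nP; apply: nr; exists n.+1%:R^-1 => // x y z t.
  wlog le12 : x y / d x z * d y t <= d x t * d y z.
    move=> H; case/orP: (le_total (d x z * d y t) (d x t * d y z)) => [/H//|L].
    have C1 : d x z * d y t = d y t * d x z by rewrite mulrC.
    have C2 : d x t * d y z = d y z * d x t by rewrite mulrC.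
    by rewrite C1 C2 maxC distrC (ds x y); apply: H; rewrite -C1 -C2.
  rewrite (max_idPr le12) => X0.
  have B0 : 0 <= d x z * d y t by rewrite mulr_ge0// gauge_ge0.
  rewrite ler0_norm ?subr_le0// opprB leNgt; apply/negP => H; apply: nP.
  have C0 : 0 < d x t * d y z.
    rewrite lt_neqAle eq_sym (le_trans B0)// andbT; apply/eqP => C0.
    by move: H; rewrite C0 mulr0 sub0r oppr_gt0 ltNge B0.
  exists [tuple x; y; z; t]; rewrite !opp_prodE; split=> //.
  by rewrite mulrBl mul1r; lra.
have {bad} [f fP] := choice bad.
pose s n := opp_prod d (f n) e1 / opp_prod d (f n) e2.
have s01 n : 0 <= s n <= 1 - e.
  have [C0 _ BC] := fP n.
  by rewrite divr_ge0 ?opp_prod_ge0//= ler_pdivrMr.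
have [u []] : `[0, 1 - e] `&` cluster (s @ \oo) !=set0.
  by apply: segment_compact; exists 0%N => // n _ /=; rewrite in_itv /= s01.
rewrite /= in_itv /= => /andP[u0 u1] cu.
suff : @Delta_bar R (homog 0 u 1) by move/homog0_Delta_bar; lra.
apply: sM => B; rewrite nbhsE => -[U [oU Up] UB].
have [r rp rU] := open_homog oU (@nonzero3_one 0 u) Up.
have [N Nr] := inv_succ_lt rp.
have {}cu : forall A B, (s @ \oo) A -> nbhs u B -> A `&` B !=set0 := cu.
have sN : (s @ \oo) [set s n | n in [set n | (N <= n)%N]].
  by exists N => // n /= Nn; exists n.
have [_ [[n Nn <-] sn]] := cu _ (ball u r) sN (nbhsx_ballx u r rp).
have [C0 A BC] := fP n.
exists (homog (opp_prod d (f n) e0 / opp_prod d (f n) e2) (s n) 1); split.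
  exists (f n); first exact: opp_prod_gt0_admissible C0.
  rewrite crtE; last exact: opp_prod_gt0_admissible C0.
  rewrite -(homog_scale (k := (opp_prod d (f n) e2)^-1)).
  - by rewrite mulVf ?gt_eqF// [X in homog X]mulrC [X in homog _ X]mulrC.
  - by rewrite invr_neq0// gt_eqF.
  - by move=> [_ _ E]; rewrite E ltxx in C0.
apply/UB/rU.
- rewrite subr0 ger0_norm ?divr_ge0 ?opp_prod_ge0// ltr_pdivrMr//.
  by apply: le_lt_trans A _; rewrite ltr_pM2r// Nr.
- by rewrite distrC.
- by rewrite subrr normr0.
Qed.

(** If the first product were much larger than the other two, then a second
    one would almost agree with it. *)
Lemma balanced_quasi_ptolemaic : balanced ->
  exists2 K, 1 <= K & quasi_ptolemaic K.
Proof.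
have [d0 ds dp] := gd.
move=> /(_ 2^-1)[|r rp H]; first by rewrite invr_gt0.
pose K := Num.max 2 r^-1.
have K2 : 2 <= K by rewrite le_max lexx.
have Kr : r^-1 <= K by rewrite le_max lexx orbT.
have K0 : 0 < K by apply: lt_le_trans K2.
exists K; first by apply: le_trans K2; rewrite ler1n.
move=> x y z t; rewrite leNgt; apply/negP => L.
have B0 : 0 <= d x z * d y t by rewrite mulr_ge0// gauge_ge0.
have C0 : 0 <= d x t * d y z by rewrite mulr_ge0// gauge_ge0.
have A0 : 0 <= d x y * d z t by rewrite mulr_ge0// gauge_ge0.
(* Apply the hypothesis to the quadruple (x, z, y, t). *)
have := H x z y t; rewrite (ds z y).
set A := d x y * _ in L A0 *; set B := d x z * _ in L B0 *.
set C := d x t * _ in L C0 *.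
have BL : K * B < A.
  by apply: le_lt_trans L; rewrite ler_pM2l// le_max lexx.
have CL : K * C < A.
  by apply: le_lt_trans L; rewrite ler_pM2l// le_max lexx orbT.
have rB : B <= r * A.
  rewrite -ler_pdivrMl//; apply/ltW; apply: le_lt_trans BL.
  by rewrite ler_wpM2r.
have CA : 2 * C < A by apply: le_lt_trans CL; rewrite ler_wpM2r.
rewrite (max_idPl _); last by lra.
move=> /(_ rB); rewrite ger0_norm; lra.
Qed.

End CrossRatioTriple.

(** * Naturality and normalisation of gauges *)
Section Naturality.
Variables (R : realType) (Z Z' : Type).
Variables (M : 4.-tuple Z -> 3.-tuple (\bar R)).
Variables (M' : 4.-tuple Z' -> 3.-tuple (\bar R)).
Variable f : Z -> Z'.
Hypothesis hf : moebius_embedding M M' f.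

Let f_eq x y : (f x = f y) = (x = y) :> Prop.
Proof. by have [finj _] := hf; apply/propext; split=> [/finj|->]. Qed.

Let log_cr_map x y z t : nondegenerate [tuple x; y; z; t] ->
  log_cr M' (f x) (f y) (f z) (f t) = log_cr M x y z t.
Proof.
have [_ hM'] := hf.
by move=> /nondegenerate_admissible a; rewrite /log_cr -map_tuple4 hM'.
Qed.

Let log_ratio_map w x y z : x <> w -> y <> w -> z <> w -> x <> y -> x <> z ->
  log_ratio M' (f w) (f x) (f y) (f z) = log_ratio M w x y z.
Proof.
move=> xw yw zw xy xz; rewrite /log_ratio f_eq.
by case: asboolP => // yz; rewrite log_cr_map//; apply/nondegenerate4.
Qed.

Lemma canonical_gauge_map w a b x y : nondegenerate [tuple w; a; b] ->
  canonical_gauge M' (f w) (f a) (f b) (f x) (f y) =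
  canonical_gauge M w a b x y.
Proof.
move=> /nondegenerate3[wa wb ab]; rewrite /canonical_gauge !f_eq.
case: asboolP => // xy; case: asboolP => // /not_orP[xw yw].
rewrite /canonical_log f_eq; case: asboolP => [xa|xa].
  by subst x; rewrite log_ratio_map//; exact: nesym.
by rewrite !log_ratio_map//; exact: nesym.
Qed.

End Naturality.

Section Normalisation.
Variables (R : realType) (Z : Type) (d : Z -> Z -> R) (p q : Z).
Implicit Types x y : Z.

(** The distance of a point to the farther of the two base points. *)
Definition height x : R := Num.max (d x p) (d x q).

(** The gauge obtained by dividing by the heights; the factor [d p q] makes it
    [normalized]. *)
Definition normalize x y : R := d p q * d x y / (height x * height y).

(** Every point is at distance 1 from one of the two base points, and at
    distance at most 1 from the other one. *)
Definition normalized : Prop := forall x, Num.max (d x p) (d x q) = 1.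

End Normalisation.

Lemma normalized_le1 (R : realType) (Z : Type) (d : Z -> Z -> R) p q :
  normalized d p q -> forall x, d x p <= 1 /\ d x q <= 1.
Proof.
by move=> nd x; split; rewrite -[leRHS](nd x) le_max lexx ?orbT.
Qed.

Lemma normalized_base_point (R : realType) (Z : Type) (d : Z -> Z -> R) p q :
  normalized d p q ->
  forall x, exists s, d x s = 1 /\ forall x', d x' s <= 1.
Proof.
move=> nd x; have le1 := normalized_le1 nd.
have := nd x; case: (leP (d x p) (d x q)) => _ E.
  by exists q; split=> // x'; have [] := le1 x'.
by exists p; split=> // x'; have [] := le1 x'.
Qed.

Section NormalisationTheory.
Variables (R : realType) (Z : Type) (d : Z -> Z -> R) (p q : Z).
Hypotheses (gd : gauge d) (pq : p <> q).
Implicit Types x y : Z.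

Let h_gt0 x : 0 < height d p q x.
Proof.
have [d0 ds dp] := gd.
have [xp|xp] := pselect (x = p); rewrite lt_max; last by rewrite dp.
by rewrite xp (dp _ _ pq) orbT.
Qed.

Lemma normalize_gauge : gauge (normalize d p q).
Proof.
have [d0 ds dp] := gd; split=> [x|x y|x y xy]; rewrite /normalize.
- by rewrite d0 mulr0 mul0r.
- by rewrite (ds x y) [height _ _ _ x * _]mulrC.
- by rewrite divr_gt0 ?mulr_gt0 ?dp.
Qed.

Lemma normalize_normalized : normalized (normalize d p q) p q.
Proof.
move=> x; have [d0 ds dp] := gd; rewrite /normalize.
have -> : height d p q p = d p q by rewrite /height d0; apply/max_idPr/ltW/dp.
have -> : height d p q q = d p q.
  by rewrite /height d0 ds; apply/max_idPl/ltW/dp.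
have dpq := dp _ _ pq; have hx := h_gt0 x.
have E u : d p q * u / (height d p q x * d p q) = (height d p q x)^-1 * u.
  by field; rewrite !gt_eqF.
by rewrite !E -maxr_pMr ?invr_ge0 ?ltW// -/(height d p q x) mulVf// gt_eqF.
Qed.

Let scale (P : 4.-tuple Z) : R :=
  d p q ^+ 2 / (height d p q (tnth P pos0) * height d p q (tnth P pos1) *
    height d p q (tnth P pos2) * height d p q (tnth P pos3)).

Let scale_gt0 P : 0 < scale P.
Proof. by have [_ _ dp] := gd; rewrite divr_gt0 ?exprn_gt0 ?mulr_gt0 ?dp. Qed.

(* The three products are multiplied by the same factor. *)
Let opp_prod_normalize P k :
  opp_prod (normalize d p q) P k = scale P * opp_prod d P k.
Proof.
rewrite /scale /opp_prod /normalize.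
have := h_gt0 (tnth P pos0); have := h_gt0 (tnth P pos1).
have := h_gt0 (tnth P pos2); have := h_gt0 (tnth P pos3).
move: (height _ _ _ _) (height _ _ _ _) (height _ _ _ _) (height _ _ _ _).
move=> h0 h1 h2 h3 p0 p1 p2 p3.
by elim/ord3_cases: k; rewrite !tnth3E; field; rewrite !gt_eqF.
Qed.

Lemma normalize_moebius_of P :
  moebius_of (normalize d p q) P = moebius_of d P.
Proof.
have [d0 ds dp] := gd.
have L k : log_opp (normalize d p q) P k =
    ((ln (scale P))%:E + log_opp d P k)%E.
  rewrite /log_opp opp_prod_normalize lne_mul ?opp_prod_ge0//; last exact/ltW.
  by rewrite lne_EFin.
have S j k : (log_opp (normalize d p q) P j - log_opp (normalize d p q) P k =
    log_opp d P j - log_opp d P k)%E.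
  rewrite !L /log_opp /lne; case: ifP => _; case: ifP => _ //=.
  by congr (_%:E); ring.
by rewrite /moebius_of !S.
Qed.

End NormalisationTheory.

(** * The Moebius topology *)

Section Topology.
Variables (R : realType) (Z : Type) (M : 4.-tuple Z -> 3.-tuple (\bar R)).

Lemma cvg_moebius_subbasis (F : set_system (moebius_topology M))
    (l : moebius_topology M) : Filter F ->
  (forall B, moebius_subbasis M B -> B l -> F B) -> F --> l.
Proof.
move=> FF H A; rewrite nbhsE => -[V [[D' D'I VE] Vl] VA].
move: Vl; rewrite -VE => -[B DB Bl].
apply: (filterS (P := B)) => [x Bx|].
  by apply: VA; rewrite -VE; exists B.
have [D'' DD BE] := D'I _ DB; rewrite -BE.
apply: filter_bigI => i iD; apply: H; first exact/set_mem/DD.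
by move: Bl; rewrite -BE; exact.
Qed.

Lemma open_moebius_subbasis (B : set (moebius_topology M)) :
  moebius_subbasis M B -> open B.
Proof.
move=> sB; exists [set B]; last by rewrite bigcup_set1.
by move=> _ ->; exact: (finI_from1 id).
Qed.

End Topology.

Section Convergence.
Variables (R : realType) (Z : Type) (M : 4.-tuple Z -> 3.-tuple (\bar R)).
Variable d : Z -> Z -> R.
Hypotheses (hM : is_moebius M) (gd : gauge d).
Hypothesis Md : forall P, admissible P -> M P = moebius_of d P.
Implicit Types x y z w a b : Z.

(** The involution of the gauge [d] that sends [w] to infinity. *)
Lemma moebius_rhoE w a b x y : nondegenerate [tuple w; a; b] -> y <> w ->
  moebius_rho M w a b x y = if `[< x = w >] then +oo%E
    else (d x y * (d a w * d w b) / (d a b * d x w * d w y))%:E.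
Proof.
move=> /nondegenerate3[wa wb ab] yw; have [d0 ds dp] := gd.
rewrite /moebius_rho; case: asboolP => [xy|xy].
  by subst y; rewrite asboolF// d0 !mul0r.
have fin u v : u <> v -> log_dist d u v = (ln (d u v))%:E.
  exact: log_dist_neq.
have expd u v : u <> v -> expR (ln (d u v)) = d u v.
  by move=> uv; rewrite lnK// posrE dp.
have adm : [/\ admissible [tuple a; x; w; b], admissible [tuple a; w; y; b] &
    admissible [tuple a; x; y; b]].
  by split; apply/admissible4; split=> -[? ?]; subst.
have [a1 a2 a3] := adm.
rewrite !Md// !moebius_ofE// /fst3 /snd3 !(tnth_nth 0%E) /=.
rewrite (fin a w (nesym wa)) (fin w b wb) (fin a b ab).
rewrite (fin w y (nesym yw)) (fin x y xy).
case: asboolP => [[xb ya]|/not_andP nxy].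
  rewrite (fin x b xb) (fin a y (nesym ya)).
  case: asboolP => [xw|xw]; first by subst x; rewrite (log_dist_refl _ gd).
  rewrite (fin x w xw) /= !(expRD, expRN) !expd//; try exact: nesym.
  by congr (_%:E); field; rewrite !gt_eqF ?dp//; exact: nesym.
have xa : x <> a by move=> xa; subst x; case: nxy => /contrapT // ya; subst.
have yb : y <> b by move=> yb; subst y; case: nxy => /contrapT // ya; subst.
rewrite (fin a x (nesym xa)) (fin y b yb).
case: asboolP => [xw|xw]; first by subst x; rewrite (log_dist_refl _ gd).
rewrite (fin x w xw) /= !(expRD, expRN) !expd//; try exact: nesym.
by congr (_%:E); field; rewrite !gt_eqF ?dp//; exact: nesym.
Qed.

(** The subbasis of the topology consists of the sets of points that are
    relatively closer to [y] than to [w]. *)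
Lemma moebius_subbasisE B : moebius_subbasis M B <->
  exists y w r, [/\ y <> w, 0 < r & B = [set x | d x y < r * d x w]].
Proof.
have [d0 ds dp] := gd.
have eqB w a b y r s : nondegenerate [tuple w; a; b] -> y <> w ->
    s = r * (d a b * d w y) / (d a w * d w b) ->
    [set x | (moebius_rho M w a b x y < r%:E)%E] = [set x | d x y < s * d x w].
  move=> nd yw ->; have /nondegenerate3[wa wb ab] := nd.
  have p1 := dp _ _ (nesym wa); have p2 := dp _ _ wb; have p3 := dp _ _ ab.
  have p4 := dp _ _ (nesym yw).
  apply/funext => x; apply/propext; rewrite /= moebius_rhoE//.
  case: asboolP => [->|xw].
    by rewrite d0 mulr0 (ltNge (d w y)) gauge_ge0.
  have p5 := dp _ _ xw.
  rewrite lte_fin ltr_pdivrMr ?mulr_gt0//.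
  have -> : r * (d a b * d w y) / (d a w * d w b) * d x w =
      r * (d a b * d x w * d w y) / (d a w * d w b) by field; rewrite !gt_eqF.
  by rewrite ltr_pdivlMr ?mulr_gt0.
split.
  move=> [w [a [b [y [r [nd r0 yw ->]]]]]].
  have /nondegenerate3[wa wb ab] := nd.
  exists y, w, (r * (d a b * d w y) / (d a w * d w b)); split=> //.
    by rewrite divr_gt0 ?mulr_gt0 ?dp//; exact: nesym.
  exact: eqB.
move=> [y [w [r [yw r0 ->]]]].
have [a [b nd]] : exists a b, nondegenerate [tuple w; a; b].
  have [[x1 [x2 [x3 [x12 x23 x13]]]] _ _ _ _] := hM.
  have [w1|w1] := pselect (w = x1).
    by exists x2, x3; apply/nondegenerate3; subst.
  have [w2|w2] := pselect (w = x2).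
    by exists x1, x3; apply/nondegenerate3; subst.
  by exists x1, x2; apply/nondegenerate3.
have /nondegenerate3[wa wb ab] := nd.
have p1 := dp _ _ (nesym wa); have p2 := dp _ _ wb; have p3 := dp _ _ ab.
have p4 := dp _ _ (nesym yw).
exists w, a, b, y, (r * (d a w * d w b) / (d a b * d w y)); split=> //.
  by rewrite divr_gt0 ?mulr_gt0.
by apply/esym/eqB => //; field; rewrite !gt_eqF.
Qed.

Variables p q : Z.
Hypothesis nd : normalized d p q.

Let d_base x : d x p <= 1 /\ d x q <= 1. Proof. exact: normalized_le1. Qed.

Let base_case x : d x p = 1 \/ d x q = 1.
Proof.
have := nd x; case: (leP (d x p) (d x q)) => _ <-; [by right|by left].
Qed.

(** Convergence in the Moebius topology is the pointwise convergence of the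
    distances to the points of the space. *)
Lemma moebius_cvg_dist (u : nat -> Z) (l : moebius_topology M) :
  ((u : nat -> moebius_topology M) @ \oo --> l) <->
  (forall y, d (u n) y @[n --> \oo] --> d l y).
Proof.
have [d0 ds dp] := gd.
split=> [ul y|ul]; last first.
  apply: cvg_moebius_subbasis => B.
  move=> /moebius_subbasisE[y [w [r [yw r0 ->]]]] /= lB.
  have : r * d (u n) w - d (u n) y @[n --> \oo] --> r * d l w - d l y.
    exact: (cvgB (cvgM (cvg_cst r) (ul w)) (ul y)).
  have H : 0 < r * d l w - d l y by rewrite subr_gt0.
  by move=> /cvgr_gt/(_ _ H); apply: filterS => n /=; rewrite subr_gt0.
have sub z w r : z <> w -> 0 < r -> d l z < r * d l w ->
    \forall n \near \oo, d (u n) z < r * d (u n) w.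
  move=> zw r0 H.
  pose B : set (moebius_topology M) := [set x | d x z < r * d x w].
  have oB : open B.
    by apply: open_moebius_subbasis; apply/moebius_subbasisE; exists z, w, r.
  by have := ul _ (open_nbhs_nbhs (conj oB (H : B l))).
(* Upper bound: compare with the base point at distance 1 from the limit. *)
have upper r : d l y < r -> \forall n \near \oo, d (u n) y < r.
  move=> H; have r0 : 0 < r by rewrite (le_lt_trans _ H)// gauge_ge0.
  have S s : d l s = 1 -> (forall n, d (u n) s <= 1) ->
      \forall n \near \oo, d (u n) y < r.
    move=> ls us; have [ys|ys] := pselect (y = s).
      by near=> n; rewrite ys; apply: le_lt_trans (us n) _; rewrite -ls -ys.
    have := sub y s r ys r0; rewrite ls mulr1 => /(_ H).
    apply: filterS => n /lt_le_trans; apply.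
    by rewrite ger_pMr.
  by case: (base_case l) => /S; apply => n; have [] := d_base (u n).
(* Lower bound: compare with both base points, since one of them is at
   distance 1 from the term of the sequence. *)
have lower r : 0 < r -> r < d l y -> \forall n \near \oo, r < d (u n) y.
  move=> r0 H.
  have S s : (forall x, d x s <= 1) ->
      \forall n \near \oo, d (u n) s = 1 -> r < d (u n) y.
    move=> s1; have [ys|ys] := pselect (s = y).
      near=> n => us1; rewrite -ys us1; apply: lt_le_trans H _.
      by rewrite -ys.
    have := sub s y r^-1 ys; rewrite invr_gt0 => /(_ r0) Q.
    apply: filterS (Q _) => [n /= L us1|].
      by move: L; rewrite us1 ltr_pdivlMl ?mulr1.
    by rewrite ltr_pdivlMl// (le_lt_trans _ H)// ger_pMr.
  have Sp := S p (fun x => (d_base x).1).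
  have Sq := S q (fun x => (d_base x).2).
  near=> n; have : d (u n) p = 1 \/ d (u n) q = 1 by [].
  case; [by near: n|by near: n].
apply/cvgrPdist_lt => e e0.
have Hu : d l y < d l y + e by rewrite ltrDl.
have {}Hu := upper _ Hu.
have Hl : \forall n \near \oo, d l y - e < d (u n) y.
  have [L|L] := ltP 0 (d l y - e); first by apply: lower => //; rewrite gtrBl.
  have [ly|/dp ly] := pselect (l = y).
    apply: nearW => n; rewrite ly d0 sub0r.
    by apply: lt_le_trans (gauge_ge0 _ _ gd); rewrite oppr_lt0.
  have h0 : 0 < d l y / 2 by rewrite divr_gt0.
  have h1 : d l y / 2 < d l y by rewrite gtr_pMr// invf_lt1// ltr1n.
  by apply: filterS (lower _ h0 h1) => n /(lt_trans h0); exact: le_lt_trans.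
near=> n; rewrite ltr_distlC; apply/andP; split; near: n => //.
Unshelve. all: by end_near.
Qed.

End Convergence.

(** * Cauchy sequences *)

Section CauchySequences.
Variables (R : realType) (Z : Type) (M : 4.-tuple Z -> 3.-tuple (\bar R)).
Variable d : Z -> Z -> R.
Hypothesis gd : gauge d.
Hypothesis Md : forall P, admissible P -> M P = moebius_of d P.
Variables p q : Z.
Hypothesis nd : normalized d p q.
Variable K : R.
Hypotheses (K1 : 1 <= K) (pK : quasi_ptolemaic d K).
Implicit Types (x y z t : Z) (u : nat -> Z).

Let d0 x : d x x = 0. Proof. by have [? _ _] := gd. Qed.
Let ds x y : d x y = d y x. Proof. by have [_ ? _] := gd. Qed.
Let dp x y : x <> y -> 0 < d x y. Proof. by have [_ _] := gd; exact. Qed.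
Let K0 : 0 < K. Proof. exact: lt_le_trans K1. Qed.

Let d_base x : d x p <= 1 /\ d x q <= 1. Proof. exact: normalized_le1. Qed.

Lemma normalized_base : d p q = 1.
Proof.
have := nd p; rewrite d0 => <-; apply/esym/max_idPr.
exact: gauge_ge0.
Qed.

Lemma quasi_ptolemaic_bounded x y : d x y <= K.
Proof.
have := pK x y p q; rewrite normalized_base mulr1 => /le_trans; apply.
rewrite -[leRHS]mulr1 ler_pM2l// ge_max.
have [xp xq] := d_base x; have [yp yq] := d_base y.
by rewrite !mulr_ile1 ?gauge_ge0.
Qed.

(** The Ptolemy inequality for [x], [z], [y] and a base point at distance 1
    from [y]. *)
Lemma quasi_ptolemaic_triangle x y z : d x z <= K * Num.max (d x y) (d y z).
Proof.
have [s [ys sle]] := normalized_base_point nd y.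
have s1 := sle x; have s2 := sle z.
have := pK x z y s; rewrite ys mulr1 => /le_trans; apply.
rewrite ler_pM2l// ge_max !le_max; apply/andP; split; apply/orP.
  by left; rewrite ler_piMr ?gauge_ge0.
by right; rewrite (ds y z) ler_piMl ?gauge_ge0.
Qed.

(** Cauchy sequences for the gauge [d]. *)
Definition dist_cauchy u : Prop := forall e, 0 < e ->
  exists N, forall n m, (N <= n)%N -> (N <= m)%N -> d (u n) (u m) < e.

Lemma thd3_le x y z t A : admissible [tuple x; y; z; t] ->
  (thd3 (M [tuple x; y; z; t]) <= A%:E)%E ->
  d x y * d z t <= expR A * (d x z * d y t).
Proof.
move=> aP; rewrite Md// /thd3 (tnth_nth 0%E) /= /log_opp.
have := opp_prod_ge0 [tuple x; y; z; t] e0 gd.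
have := opp_prod_ge0 [tuple x; y; z; t] e1 gd.
rewrite !opp_prodE; move: (d x z * _) (d x y * _) => X1 X0 X1_ge0 X0_ge0.
have [X1p|X1n] := ltP 0 X1; last first.
  have -> : X1 = 0 by apply/le_anti; rewrite X1n.
  have [X0p|X0n] := ltP 0 X0; first by rewrite lne_EFin//= lexx.
  by rewrite mulr0.
have [X0p|X0n] := ltP 0 X0; last first.
  by move=> _; apply: le_trans X0n _; rewrite mulr_ge0// expR_ge0.
rewrite !lne_EFin// -EFinB lee_fin lerBlDr => H.
have : expR (ln X0) <= expR (A + ln X1) by rewrite ler_expR.
by rewrite expRD !lnK ?posrE.
Qed.

Lemma le_thd3 x y z t A : admissible [tuple x; y; z; t] ->
  0 < d x z * d y t -> d x y * d z t <= expR A * (d x z * d y t) ->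
  (thd3 (M [tuple x; y; z; t]) <= A%:E)%E.
Proof.
move=> aP X1p; rewrite Md// /thd3 (tnth_nth 0%E) /= /log_opp.
have := opp_prod_ge0 [tuple x; y; z; t] e0 gd.
rewrite !opp_prodE; move: (d x z * _) (d x y * _) X1p => X1 X0 X1p X0_ge0.
have [X0p|X0n] := ltP 0 X0; last first.
  by rewrite /lne X0n (lt_geF X1p) addNye leNye.
rewrite !lne_EFin// -EFinB lee_fin lerBlDr => H.
by rewrite -ler_expR expRD !lnK ?posrE.
Qed.

(** The quasi-metric in the definition of Cauchy sequences plays no role here:
    the bound on [thd3] controls [d (u n) (u m)] because [d] is bounded. *)
Lemma moebius_cauchy_dist u : moebius_cauchy M u -> dist_cauchy u.
Proof.
move=> [rho [y [z [_ _ [yz _ _ _ _] adm cv]]]] e e0.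
have yz0 := dp yz.
pose A := ln (e / 2 * d y z / K ^+ 2).
have a0 : 0 < e / 2 * d y z / K ^+ 2.
  by rewrite divr_gt0 ?mulr_gt0 ?exprn_gt0// divr_gt0.
have [[A1 A2] /= [[N1 _ H1] [N2 _ H2]] H] := filterI adm ((cvgeNyPle _).1 cv A).
exists (maxn N1 N2) => n m; rewrite !geq_max => /andP[n1 n2] /andP[m1 m2].
have [/= anm /(thd3_le anm)] := H (n, m) (conj (H1 n n1) (H2 m m2)).
rewrite lnK ?posrE// => L.
have L2 : d (u n) y * d (u m) z <= K ^+ 2.
  by rewrite expr2 ler_pM ?gauge_ge0// quasi_ptolemaic_bounded.
have : d (u n) (u m) * d y z <= e / 2 * d y z.
  apply: le_trans L _; rewrite -[leRHS](@divfK _ (K ^+ 2)) ?gt_eqF ?exprn_gt0//.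
  by rewrite ler_pM2l.
rewrite ler_pM2r// => /le_lt_trans; apply.
by rewrite gtr_pMr// invf_lt1// ltr1n.
Qed.

Let away u y : Prop := exists2 e, 0 < e & exists N, forall n, (N <= n)%N ->
  e <= d (u n) y.

(** A Cauchy sequence stays away from one of any two points. *)
Let cauchy_away u a b : dist_cauchy u -> a <> b -> away u a \/ away u b.
Proof.
move=> cu ab; have ab0 := dp ab.
apply: contrapT => /not_orP[na nb].
pose e := d a b / (2 * K ^+ 2).
have e0 : 0 < e by rewrite divr_gt0 ?mulr_gt0 ?exprn_gt0.
have [N cN] := cu _ e0.
have close c : ~ away u c -> exists2 n, (N <= n)%N & d (u n) c < e.
  move=> nc; apply: contrapT => H; apply: nc; exists e => //; exists N => n Nn.
  by rewrite leNgt; apply/negP => L; apply: H; exists n.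
have [n Nn un] := close _ na; have [m Nm um] := close _ nb.
have T1 := quasi_ptolemaic_triangle a (u n) b.
have T2 := quasi_ptolemaic_triangle (u n) (u m) b.
have L2 : d (u n) b <= K * e.
  by apply: le_trans T2 _; rewrite ler_pM2l// ge_max !ltW// cN.
have : d a b <= K * (K * e).
  apply: le_trans T1 _; rewrite ler_pM2l// ge_max L2 andbT (ds a) ltW//.
  by apply: lt_le_trans un _; rewrite ler_peMl// ltW.
have -> : K * (K * e) = d a b / 2 by rewrite /e; field; rewrite gt_eqF.
by rewrite leNgt gtr_pMr// invf_lt1// ltr1n.
Qed.

Let away_notcvg u y : away u y -> ~ ((d (u n) y)%:E @[n --> \oo] --> 0%E).
Proof.
move=> [e e0 [N H]] /fine_cvgP[_] /cvgr_lt/(_ _ e0)[N' _ H'].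
have := H' (maxn N N') (leq_maxr _ _); rewrite /= ltNge H//.
exact: leq_maxl.
Qed.

Lemma dist_cauchy_moebius u r : p <> q -> q <> r -> p <> r ->
  dist_cauchy u -> moebius_cauchy M u.
Proof.
move=> pq qr pr cu.
(* Two of the three given points form a good pair. *)
have [y [z [yz ay az]]] : exists y z, [/\ y <> z, away u y & away u z].
  have [ap|aq] := cauchy_away cu pq.
    have [aq|ar] := cauchy_away cu qr; first by exists p, q.
    by exists p, r.
  have [ap|ar] := cauchy_away cu pr; first by exists p, q.
  by exists q, r.
pose rho x y := (d x y)%:E.
have notinf x : ~ point_at_infinity rho x.
  move=> [H _]; have [xp|xp] := pselect (p = x).
    by have := H q; rewrite -xp => /(_ (nesym pq)).
  by have := H p xp.
have [ey ey0 [Ny Hy]] := ay; have [ez ez0 [Nz Hz]] := az.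
have [N NE] : exists N, N = maxn Ny Nz by exists (maxn Ny Nz).
have {}Hy n : (N <= n)%N -> ey <= d (u n) y.
  by rewrite NE geq_max => /andP[/Hy].
have {}Hz n : (N <= n)%N -> ez <= d (u n) z.
  by rewrite NE geq_max => /andP[_ /Hz].
have admN n m : (N <= n)%N -> (N <= m)%N -> admissible [tuple u n; u m; y; z].
  move=> Nn Nm.
  have uy k : (N <= k)%N -> u k <> y.
    by move=> /Hy + E; rewrite E d0 leNgt ey0.
  have uz k : (N <= k)%N -> u k <> z.
    by move=> /Hz + E; rewrite E d0 leNgt ez0.
  have := uy n Nn; have := uy m Nm; have := uz n Nn; have := uz m Nm.
  by move=> ? ? ? ?; apply/admissible4; split=> -[? ?]; subst.
exists rho, y, z; split.
- exists K; left; split=> //.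
  + by move=> a b _ _; rewrite /rho lee_fin gauge_ge0.
  + by move=> a b _ _; rewrite /rho ds.
  + move=> a b _ _; rewrite /rho; split=> [[/(gauge_eq0 gd)]//|->].
    by rewrite d0.
  + move=> a b c _ _ _; rewrite /rho -EFin_max -EFinM lee_fin.
    exact: quasi_ptolemaic_triangle.
- by move=> z1 z2 z3 z4 a; rewrite (crtE gd Md a).
- by split=> //; exact: away_notcvg.
- exists ([set n | (N <= n)%N], [set n | (N <= n)%N]).
    by split; exists N.
  by move=> [n m] /= [Nn Nm]; exact: admN.
apply/cvgeNyPle => A.
pose e := expR A * (ey * ez) / K.
have ep : 0 < e by rewrite divr_gt0 ?mulr_gt0 ?expR_gt0.
have [N' cN'] := cu _ ep.
exists ([set n | (maxn N N' <= n)%N], [set n | (maxn N N' <= n)%N]).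
  by split; exists (maxn N N').
move=> [n m] /= [].
rewrite !geq_max => /andP[Nn N'n] /andP[Nm N'm].
have [yn zm] := (Hy n Nn, Hz m Nm).
apply: le_thd3; first exact: admN.
  by apply: mulr_gt0; [exact: lt_le_trans yn|exact: lt_le_trans zm].
apply: (@le_trans _ _ (e * K)).
  by rewrite ler_pM ?gauge_ge0 ?quasi_ptolemaic_bounded// ltW// cN'.
rewrite /e divfK ?gt_eqF// ler_pM2l ?expR_gt0//.
by rewrite ler_pM// ltW.
Qed.

End CauchySequences.

(** * The completion *)

(** The uniform distance between the functions [d x] and [d x'] is small as
    soon as [d x x'] is; the converse is clear, by evaluation at [x']. *)
Definition uniform_dist (R : realType) (Z : Type) (d : Z -> Z -> R) : Prop :=
  forall e, 0 < e -> exists2 r, 0 < r &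
  forall x x', d x x' < r -> forall y, `|d x y - d x' y| <= e.

Section UniformContinuity.
Variables (R : realType) (Z : Type) (d : Z -> Z -> R) (p q : Z) (K : R).
Hypotheses (gd : gauge d) (nd : normalized d p q).
Hypotheses (K1 : 1 <= K) (pK : quasi_ptolemaic d K).
Hypothesis bd : balanced d.
Implicit Types x y : Z.

Lemma balanced_uniform : uniform_dist d.
Proof.
move=> e e0; have K0 : 0 < K by apply: lt_le_trans K1.
have K10 : 0 < K + 1 by rewrite addr_gt0.
have bnd := quasi_ptolemaic_bounded gd nd K1 pK.
pose e1 := e / (K + 1).
have e10 : 0 < e1 by rewrite divr_gt0.
have [r r0 br] := bd (divr_gt0 e10 K0).
exists (r * e1); first by rewrite mulr_gt0.
have dbase := normalized_le1 nd.
move=> x x' xx'.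
have [s [t [xs s1 t1 st]]] : exists s t, [/\ d x s = 1, forall z, d z s <= 1,
    forall z, d z t <= 1 & forall z, d z s = 1 \/ d z t = 1].
  have := nd x; case: (leP (d x p) (d x q)) => _ E.
    exists q, p; split=> //; try by move=> z; have [] := dbase z.
    by move=> z; have := nd z; case: (leP (d z p) (d z q)) => _; [left|right].
  exists p, q; split=> //; try by move=> z; have [] := dbase z.
  by move=> z; have := nd z; case: (leP (d z p) (d z q)) => _; [right|left].
(* The hypothesis on [d] for the quadruple (x, x', y, s). *)
have core y : `|d x y * d x' s - d x' y| <= e1.
  have := br x x' y s; rewrite xs mul1r.
  have B0 : 0 <= d x y * d x' s by rewrite mulr_ge0 ?gauge_ge0.
  have BK : d x y * d x' s <= K by rewrite -[leRHS]mulr1 ler_pM ?gauge_ge0.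
  have C0 : 0 <= d x' y by rewrite gauge_ge0.
  have CK := bnd x' y.
  move: B0 BK C0 CK; move: (d x y * d x' s) (d x' y) => B C B0 BK C0 CK.
  have mK : Num.max B C <= K by rewrite ge_max BK.
  have [L _|L H] := leP (Num.max B C) e1.
    by move: L; rewrite ge_max ler_norml => /andP[? ?]; apply/andP; split; lra.
  have A : d x x' * d y s <= r * Num.max B C.
    apply: (@le_trans _ _ (r * e1)); last by rewrite ler_pM2l// ltW.
    by rewrite -[leRHS]mulr1 ler_pM ?gauge_ge0// ltW.
  apply: le_trans (H A) _; rewrite -[leRHS](@divfK _ K) ?gt_eqF//.
  by rewrite ler_pM2l// divr_gt0.
(* The other base point shows that [d x' s] is close to [d x s = 1]. *)
have near1 : 1 - e1 <= d x' s.
  case: (st x') => [->|x't]; first by rewrite gerBl ltW.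
  have := core t; rewrite x't ler_norml => /andP[H _].
  have : d x t * d x' s <= d x' s by rewrite ler_piMl ?gauge_ge0.
  lra.
move=> y; have := core y; have := bnd x y; have := s1 x'.
have ee : e = K * e1 + e1 by rewrite /e1; field; rewrite gt_eqF.
rewrite ee => h1 h2.
have h3 : `|d x y - d x y * d x' s| <= K * e1.
  rewrite -{1}[d x y]mulr1 -mulrBr normrM ler_pM ?normr_ge0//.
    by rewrite ger0_norm ?gauge_ge0.
  by rewrite ger0_norm ?subr_ge0//; lra.
move=> h4; have -> : d x y - d x' y = (d x y - d x y * d x' s) +
  (d x y * d x' s - d x' y) by ring.
by apply: le_trans (ler_normD _ _) _; exact: lerD.
Qed.

End UniformContinuity.

Lemma moebius_of_map (R : realType) (Z Z' : Type) (d : Z -> Z -> R)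
    (d' : Z' -> Z' -> R) (f : Z -> Z') :
  (forall x y, d' (f x) (f y) = d x y) ->
  forall P, moebius_of d' (map_tuple f P) = moebius_of d P.
Proof.
move=> fd; apply: tuple4_ind => x y z t; rewrite map_tuple4.
have E k : opp_prod d' [tuple f x; f y; f z; f t] k =
    opp_prod d [tuple x; y; z; t] k.
  by elim/ord3_cases: k; rewrite !opp_prodE !fd.
by rewrite /moebius_of /log_opp !E.
Qed.

Lemma cvg_maxr (R : realType) (u v : nat -> R) (a b : R) :
  u n @[n --> \oo] --> a -> v n @[n --> \oo] --> b ->
  Num.max (u n) (v n) @[n --> \oo] --> Num.max a b.
Proof.
move=> ua vb.
have -> : (fun n => Num.max (u n) (v n)) =
    (fun n => (u n + v n + `|u n - v n|) / 2).
  by apply/funext => n; rewrite maxr_absE.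
rewrite maxr_absE; apply: cvgM; last exact: cvg_cst.
exact: (cvgD (cvgD ua vb) (cvg_norm (cvgB ua vb))).
Qed.

Lemma cvg_uniq (R : realType) (u v : nat -> R) (a b : R) : u =1 v ->
  u n @[n --> \oo] --> a -> v n @[n --> \oo] --> b -> a = b.
Proof.
move=> /funext -> ua ub; exact: cvg_unique ua ub.
Qed.

Section Completion.
Variables (R : realType) (Z : Type) (d : Z -> Z -> R) (p q : Z) (K : R).
Hypotheses (gd : gauge d) (nd : normalized d p q).
Hypotheses (K1 : 1 <= K) (pK : quasi_ptolemaic d K).
Hypothesis unif : uniform_dist d.
Implicit Types (x y z : Z) (e : R).

(** The function [f] is within uniform distance [e] of [d x]. *)
Definition uniform_approx (f : Z -> R) x e : Prop :=
  forall y, `|f y - d x y| <= e.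

(** The completion: the uniform limits of the functions [d x].  A point of the
    completion is thus given by its distances to the points of [Z]. *)
Definition completion : Type :=
  {f : Z -> R | forall e, 0 < e -> exists x, uniform_approx f x e}.
Implicit Types f g h : completion.

Let approx f x e : Prop := uniform_approx (sval f) x e.

Let d0 x : d x x = 0. Proof. by have [? _ _] := gd. Qed.
Let ds x y : d x y = d y x. Proof. by have [_ ? _] := gd. Qed.

Lemma completion_embed_subproof x e : 0 < e ->
  exists x', uniform_approx (d x) x' e.
Proof. by move=> e0; exists x => y; rewrite subrr normr0 ltW. Qed.

(** The embedding of [Z] into its completion. *)
Definition completion_embed x : completion :=
  exist _ (d x) (@completion_embed_subproof x).

Let approx_embed x : approx (completion_embed x) x 0.
Proof. by move=> y /=; rewrite subrr normr0. Qed.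

Let d_lip x x' y e : (forall z, `|d x z - d x' z| <= e) -> d x y <= d x' y + e.
Proof. by move=> /(_ y); rewrite ler_norml => /andP[_]; rewrite lerBlDl. Qed.

Let approx_lip f x x' e e' : approx f x e -> approx f x' e' ->
  forall z, `|d x z - d x' z| <= e + e'.
Proof.
move=> fx fx' z.
have -> : d x z - d x' z = (d x z - sval f z) + (sval f z - d x' z) by ring.
by apply: le_trans (ler_normD _ _) _; rewrite lerD// distrC.
Qed.

Let dist_set f g : set R := [set r | exists x y e e',
  [/\ approx f x e, approx g y e' & r = d x y - e - e']].

(** The extension of [d] to the completion.  As [d] is nonexpansive in each
    variable for the uniform distance, it is the limit of [d x y] when [d x]
    and [d y] tend to [f] and [g]; the supremum avoids choosing sequences. *)
Definition completion_dist f g : R := sup (dist_set f g).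

Let dist_set_ub f g x y e e' : approx f x e -> approx g y e' ->
  ubound (dist_set f g) (d x y + e + e').
Proof.
move=> fx gy _ [x1 [y1 [e1 [e1' [fx1 gy1 ->]]]]].
have := d_lip y1 (approx_lip fx1 fx); have := d_lip x (approx_lip gy1 gy).
by rewrite (ds y1 x) (ds y x); lra.
Qed.

Lemma completion_dist_approx f g x y e e' : approx f x e -> approx g y e' ->
  `|completion_dist f g - d x y| <= e + e'.
Proof.
move=> fx gy; have ub := dist_set_ub fx gy.
have inS : dist_set f g (d x y - e - e') by exists x, y, e, e'.
rewrite ler_distl; apply/andP; split.
  by rewrite opprD addrA; apply: ub_le_sup => //; exists (d x y + e + e').
by rewrite addrA; apply: ge_sup => //; exists (d x y - e - e').
Qed.

Let approx_ex f : exists u : nat -> Z, forall n, approx f (u n) n.+1%:R^-1.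
Proof.
have H n : exists x, approx f x n.+1%:R^-1 by apply: (svalP f).
by have [u uP] := choice H; exists u.
Qed.

(** A sequence of points of [Z] converging to a point of the completion. *)
Definition approx_seq f : nat -> Z := sval (cid (approx_ex f)).

Lemma approx_seqP f n : approx f (approx_seq f n) n.+1%:R^-1.
Proof. exact: (svalP (cid (approx_ex f))). Qed.

Let cvg_harmonic2 : (n.+1%:R^-1 + n.+1%:R^-1 : R) @[n --> \oo] --> (0 : R).
Proof. by rewrite -[X in _ --> X]addr0; apply: cvgD; exact: cvg_harmonic. Qed.

Let cvg_dist_le (u v : nat -> R) l : (forall n, `|u n - l| <= v n) ->
  v n @[n --> \oo] --> (0 : R) -> u n @[n --> \oo] --> l.
Proof.
move=> uv v0; apply/cvgrPdist_le => e e0.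
move/cvgrPdist_le: v0 => /(_ _ e0); apply: filterS => n.
rewrite sub0r normrN distrC => H; apply: le_trans (uv n) _.
exact: le_trans (ler_norm _) H.
Qed.

Lemma cvg_completion_dist f g :
  d (approx_seq f n) (approx_seq g n) @[n --> \oo] --> completion_dist f g.
Proof.
apply: cvg_dist_le cvg_harmonic2 => n; rewrite distrC.
exact: completion_dist_approx (approx_seqP f n) (approx_seqP g n).
Qed.

Lemma completion_dist_lip f f' g e : (forall y, `|sval f y - sval f' y| <= e) ->
  `|completion_dist f g - completion_dist f' g| <= e.
Proof.
move=> ff'; apply/ler_addgt0Pr => r r0.
have r4 : 0 < r / 4 by rewrite divr_gt0.
have [x fx] := svalP f _ r4; have [y gy] := svalP g _ r4.
have f'x : approx f' x (r / 4 + e).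
  move=> z; have -> : sval f' z - d x z =
    (sval f z - d x z) + (sval f' z - sval f z) by ring.
  by apply: le_trans (ler_normD _ _) _; rewrite lerD ?fx// distrC.
have := completion_dist_approx (fx : approx f x _) (gy : approx g y _).
have := completion_dist_approx f'x (gy : approx g y _).
move: (completion_dist f g) (completion_dist f' g) (d _ _) => a b c.
by rewrite !ler_norml => /andP[? ?] /andP[? ?]; apply/andP; split; lra.
Qed.

Lemma completion_dist_embedr f y :
  completion_dist f (completion_embed y) = sval f y.
Proof.
apply/eqP; rewrite -subr_eq0 -normr_le0.
apply/ler_addgt0Pr => r r0; rewrite add0r.
have [x fx] := svalP f _ (divr_gt0 r0 (ltr0Sn R 1)).
have := completion_dist_approx (fx : approx f x _) (approx_embed y).
have := fx y.
move: (completion_dist f _) (sval f y) (d _ _) => a b c.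
by rewrite !ler_norml => /andP[? ?] /andP[? ?]; apply/andP; split; lra.
Qed.

Lemma completion_dist_embed x y :
  completion_dist (completion_embed x) (completion_embed y) = d x y.
Proof. exact: completion_dist_embedr. Qed.

Lemma completion_eq f g : sval f =1 sval g -> f = g.
Proof.
case: f g => f Pf [g Pg] /= /funext E; subst g.
by congr exist; exact: Prop_irrelevance.
Qed.

Lemma completion_gauge : gauge completion_dist.
Proof.
have lim0 f g : 0 <= completion_dist f g.
  apply: (cvgr_to_ge (@cvg_completion_dist f g)).
  by apply: nearW => n; exact: gauge_ge0.
split.
- move=> f; apply: cvg_uniq (@cvg_completion_dist f f) (cvg_cst 0).
  by move=> n; rewrite d0.
- move=> f g.
  apply: cvg_uniq (@cvg_completion_dist f g) (@cvg_completion_dist g f).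
  by move=> n; rewrite ds.
- move=> f g fg; rewrite lt_neqAle lim0 andbT eq_sym.
  apply/eqP => fg0; apply: fg.
  apply: completion_eq => z; apply/eqP; rewrite -subr_eq0 -normr_le0.
  apply/ler_addgt0Pr => e e0; rewrite add0r.
  have [r r0 H] := unif (divr_gt0 e0 (ltr0Sn R 1)).
  have m0 : 0 < Num.min (e / 4) (r / 4) by rewrite lt_min !divr_gt0.
  have [x fx] := svalP f _ m0; have [y gy] := svalP g _ m0.
  have := completion_dist_approx (fx : approx f x _) (gy : approx g y _).
  have m1 : Num.min (e / 4) (r / 4) <= e / 4 by rewrite ge_min lexx.
  have m2 : Num.min (e / 4) (r / 4) <= r / 4 by rewrite ge_min lexx orbT.
  rewrite fg0 sub0r normrN ger0_norm ?gauge_ge0// => xy.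
  have xyr : d x y < r by lra.
  have := H x y xyr z; have := fx z; have := gy z.
  move: (sval f z) (sval g z) (d x z) (d y z) => a b a' b'.
  rewrite !ler_norml => /andP[? ?] /andP[? ?] /andP[? ?].
  by apply/andP; split; lra.
Qed.

Lemma completion_quasi_ptolemaic : quasi_ptolemaic completion_dist K.
Proof.
move=> f g h k.
have C := fun a b => @cvg_completion_dist a b.
apply: (ler_cvg_to (cvgM (C f g) (C h k)) (cvgM (cvg_cst K)
  (cvg_maxr (cvgM (C f h) (C g k)) (cvgM (C f k) (C g h))))).
by apply: nearW => n; exact: pK.
Qed.

Lemma completion_normalized :
  normalized completion_dist (completion_embed p) (completion_embed q).
Proof.
move=> f; rewrite !completion_dist_embedr.
have C y : d (approx_seq f n) y @[n --> \oo] --> sval f y.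
  apply: cvg_dist_le cvg_harmonic => n; rewrite distrC; exact: approx_seqP.
have Cm := cvg_maxr (C p) (C q).
apply/le_anti/andP; split; [apply: (cvgr_to_le Cm)|apply: (cvgr_to_ge Cm)].
  by apply: nearW => n; rewrite nd.
by apply: nearW => n; rewrite nd.
Qed.

Lemma approx_seq_cauchy f : dist_cauchy d (approx_seq f).
Proof.
move=> e e0.
have e20 : 0 < e / 2 by rewrite divr_gt0.
have [N L] := inv_succ_lt e20; exists N => n m Nn Nm.
have := approx_lip (approx_seqP f n) (approx_seqP f m) (approx_seq f m).
rewrite d0 subr0 => /(le_trans (ler_norm _)).
have := L n Nn; have := L m Nm.
by move: (n.+1%:R^-1) (m.+1%:R^-1) (d _ _) => a b c; lra.
Qed.

(** A Cauchy sequence has a uniform limit in the completion. *)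
Lemma dist_cauchy_limit (u : nat -> Z) : dist_cauchy d u ->
  exists f, forall e, 0 < e -> exists N, forall n, (N <= n)%N ->
    approx f (u n) e.
Proof.
move=> cu.
have ucu e : 0 < e -> exists N, forall n m, (N <= n)%N -> (N <= m)%N ->
    forall y, `|d (u n) y - d (u m) y| <= e.
  move=> /unif[r r0 H]; have [N HN] := cu _ r0.
  by exists N => n m Nn Nm; apply: H; exact: HN.
have C y : cvgn (fun n => d (u n) y).
  apply/cauchy_cvgP/cauchy_exP => e e0.
  have [N HN] := ucu _ (divr_gt0 e0 (ltr0Sn R 1)).
  exists (d (u N) y); exists N => // n /= Nn.
  rewrite /ball /=; apply: le_lt_trans (HN _ _ (leqnn _) Nn y) _.
  by rewrite gtr_pMr// invf_lt1// ltr1n.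
pose l y := limn (fun n => d (u n) y).
have lP e : 0 < e -> exists N, forall n, (N <= n)%N -> uniform_approx l (u n) e.
  move=> /ucu[N HN]; exists N => n Nn y; rewrite distrC.
  have D : `|d (u n) y - d (u m) y| @[m --> \oo] --> `|d (u n) y - l y|.
    by apply: cvg_norm; apply: cvgB; [exact: cvg_cst|exact: C].
  apply: (cvgr_to_le D); exists N => // m Nm.
  exact: HN.
have lZ e : 0 < e -> exists x, uniform_approx l x e.
  by move=> /lP[N HN]; exists (u N); exact: HN.
by exists (exist _ l lZ).
Qed.

End Completion.

Section NormalGauge.
Variables (R : realType) (Z : Type) (M : 4.-tuple Z -> 3.-tuple (\bar R)).
Implicit Types w a b : Z.

(** The gauge defining [M], normalised at the first two of three points. *)
Definition normal_gauge w a b : Z -> Z -> R :=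
  normalize (canonical_gauge M w a b) w a.

Hypothesis hM : is_moebius M.

Lemma normal_gaugeP w a b : nondegenerate [tuple w; a; b] ->
  [/\ gauge (normal_gauge w a b), normalized (normal_gauge w a b) w a &
      forall P, admissible P -> M P = moebius_of (normal_gauge w a b) P].
Proof.
move=> nd; have /nondegenerate3[wa _ _] := nd.
have gd := canonical_gauge_gauge hM nd.
split; [exact: normalize_gauge|exact: normalize_normalized|].
by move=> P aP; rewrite normalize_moebius_of// -canonical_gauge_moebius.
Qed.

End NormalGauge.

Lemma normal_gauge_map (R : realType) (Z Z' : Type)
    (M : 4.-tuple Z -> 3.-tuple (\bar R))
    (M' : 4.-tuple Z' -> 3.-tuple (\bar R)) (f : Z -> Z') w a b :
  moebius_embedding M M' f -> nondegenerate [tuple w; a; b] ->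
  forall x y, normal_gauge M' (f w) (f a) (f b) (f x) (f y) =
              normal_gauge M w a b x y.
Proof.
move=> hf nd x y; rewrite /normal_gauge /normalize /height.
by rewrite !(canonical_gauge_map hf).
Qed.

Section CompletionSpace.
Variables (R : realType) (Z : Type) (d : Z -> Z -> R) (p q r : Z) (K : R).
Hypotheses (gd : gauge d) (nd : normalized d p q).
Hypotheses (K1 : 1 <= K) (pK : quasi_ptolemaic d K).
Hypothesis unif : uniform_dist d.
Hypotheses (pq : p <> q) (qr : q <> r) (pr : p <> r).

Notation Zbar := (completion d).
Notation dbar := (@completion_dist R Z d).
Notation iZ := (@completion_embed R Z d).
Notation Mbar := (moebius_of dbar).

Let dbar_gauge : gauge dbar. Proof. exact: completion_gauge. Qed.

Lemma completion_embed_inj : injective iZ.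
Proof.
move=> x y E; apply: (gauge_eq0 gd).
by rewrite -(completion_dist_embed gd) // E; have [->] := dbar_gauge.
Qed.

Lemma completion_is_moebius : is_moebius Mbar.
Proof.
apply: moebius_of_is_moebius => //.
exists (iZ p), (iZ q), (iZ r).
by split=> /completion_embed_inj.
Qed.

Lemma completion_is_strong : is_strong_moebius Mbar.
Proof.
split; first exact: completion_is_moebius.
apply: (quasi_ptolemaic_corner dbar_gauge) K1 _ => //.
exact: completion_quasi_ptolemaic.
Qed.

(** Uniform convergence implies convergence in the Moebius topology. *)
Let uniform_cvg (u : nat -> Zbar) (l : moebius_topology Mbar) :
  (forall e, 0 < e -> exists N, forall n, (N <= n)%N ->
     forall y, `|sval (u n) y - sval (l : Zbar) y| <= e) ->
  (u : nat -> moebius_topology Mbar) @ \oo --> l.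
Proof.
move=> H; apply/(moebius_cvg_dist completion_is_moebius dbar_gauge _
  (completion_normalized gd nd)) => // g.
apply/cvgrPdist_le => e e0; have [N HN] := H e e0.
exists N => // n /= Nn; rewrite distrC.
by apply: completion_dist_lip => //; exact: HN.
Qed.

Lemma completion_complete : moebius_complete Mbar.
Proof.
move=> u mu.
have cu : dist_cauchy dbar u.
  have ndbar := completion_normalized gd nd.
  apply: (moebius_cauchy_dist dbar_gauge _ ndbar K1 _ mu) => //.
  exact: completion_quasi_ptolemaic.
have [x xP] : exists x : nat -> Z,
    forall n, uniform_approx d (sval (u n)) (x n) n.+1%:R^-1.
  have H n : exists y, uniform_approx d (sval (u n)) y n.+1%:R^-1.
    by apply: (svalP (u n)).
  by have [x xP] := choice H; exists x.
have cx : dist_cauchy d x.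
  move=> e e0; have e3 : 0 < e / 3 by rewrite divr_gt0.
  have [N1 H1] := inv_succ_lt e3; have [N2 H2] := cu _ e3.
  exists (maxn N1 N2) => n m; rewrite !geq_max => /andP[n1 n2] /andP[m1 m2].
  have := completion_dist_approx gd (xP n) (xP m).
  have := H1 n n1; have := H1 m m1; have := H2 n m n2 m2.
  move: (n.+1%:R^-1) (m.+1%:R^-1) (d _ _) (dbar _ _) => a b c c' h1 h2 h3.
  by rewrite ler_norml => /andP[? ?]; lra.
have [f fP] := dist_cauchy_limit unif cx.
exists (f : moebius_topology Mbar); apply: uniform_cvg => e e0.
have e2 : 0 < e / 2 by rewrite divr_gt0.
have [N1 H1] := inv_succ_lt e2; have [N2 H2] := fP _ e2.
exists (maxn N1 N2) => n; rewrite !geq_max => /andP[n1 n2] y.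
have := xP n y; have := H2 n n2 y; have := H1 n n1.
move: (n.+1%:R^-1) (sval (u n) y) (sval f y) (d _ _) => a b c c' h1.
by rewrite !ler_norml => /andP[? ?] /andP[? ?]; apply/andP; split; lra.
Qed.

Lemma completion_dense : moebius_dense Mbar (range iZ).
Proof.
move=> V [l0 Vl] oV; pose l : Zbar := l0.
have : (iZ \o approx_seq l : nat -> moebius_topology Mbar) @ \oo --> l0.
  apply: uniform_cvg => e e0.
  have [N Ne] := inv_succ_lt e0; exists N => n Nn y; rewrite distrC.
  exact: le_trans (approx_seqP l n y) (ltW (Ne n Nn)).
move=> /(_ V (open_nbhs_nbhs (conj oV Vl)))[N _ /(_ N (leqnn N)) /= VN].
by exists (iZ (approx_seq l N)); split=> //; exists (approx_seq l N).
Qed.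

End CompletionSpace.

(** * The universal property *)

Section Universal.
Variables (R : realType) (Z : Type) (d : Z -> Z -> R) (p q r : Z) (K : R).
Hypotheses (gd : gauge d) (nd : normalized d p q).
Hypotheses (K1 : 1 <= K) (pK : quasi_ptolemaic d K).
Hypothesis unif : uniform_dist d.
Hypotheses (pq : p <> q) (qr : q <> r) (pr : p <> r).

Variables (Z' : Type) (M' : 4.-tuple Z' -> 3.-tuple (\bar R)) (i : Z -> Z').
Variables (d' : Z' -> Z' -> R) (K' : R).
Hypotheses (hM' : is_moebius M') (cM' : moebius_complete M').
Hypothesis denseM' : moebius_dense M' (range i).
Hypotheses (gd' : gauge d') (nd' : normalized d' (i p) (i q)).
Hypothesis Md' : forall P, admissible P -> M' P = moebius_of d' P.
Hypotheses (K1' : 1 <= K') (pK' : quasi_ptolemaic d' K').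
Hypothesis di : forall x y, d' (i x) (i y) = d x y.

Notation Zbar := (completion d).
Notation dbar := (@completion_dist R Z d).
Notation iZ := (@completion_embed R Z d).

Let i_inj x y : x <> y -> i x <> i y.
Proof.
have [d0 ds dp] := gd; have [d0' _ _] := gd'.
by move=> /dp xy E; rewrite -di E d0' ltxx in xy.
Qed.

Let d'C x y : d' x y = d' y x. Proof. by have [_ ? _] := gd'. Qed.

(** A Cauchy sequence of [Z] converges in [Z']. *)
Let cauchy_cvg (u : nat -> Z) : dist_cauchy d u ->
  exists z', forall y', d' (i (u n)) y' @[n --> \oo] --> d' z' y'.
Proof.
move=> cu; have cu' : dist_cauchy d' (i \o u).
  by move=> e /cu[N HN]; exists N => n m Nn Nm; rewrite /= di HN.
have mu := dist_cauchy_moebius gd' Md' nd' K1' pK'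
  (i_inj pq) (i_inj qr) (i_inj pr) cu'.
have [l ul] := cM' mu; exists l.
exact/(moebius_cvg_dist hM' gd' Md' nd').
Qed.

(** Every point of [Z'] is the limit of a Cauchy sequence of [Z]. *)
Let dense_seq z' : exists2 u : nat -> Z, dist_cauchy d u &
  forall y', d' (i (u n)) y' @[n --> \oo] --> d' z' y'.
Proof.
have [d0' _ dp'] := gd'.
have [s [zs s1]] := normalized_base_point nd' z'.
have z's : z' <> s by move=> E; move/eqP: zs; rewrite E d0' eq_sym oner_eq0.
have close (n : nat) : exists x, d' (i x) z' < n.+1%:R^-1.
  (* A neighbourhood of [z'] contained in the ball of radius [n.+1%:R^-1]. *)
  pose B : set (moebius_topology M') := [set x | d' x z' < n.+1%:R^-1 * d' x s].
  have oB : open B.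
    apply: open_moebius_subbasis; apply/(moebius_subbasisE hM' gd' Md').
    by exists z', s, n.+1%:R^-1.
  have B0 : B !=set0 by exists z'; rewrite /B /= d0' zs mulr1.
  have [x0 [Bx [x _ xE]]] := denseM' B0 oB.
  exists x; apply: lt_le_trans (_ : n.+1%:R^-1 * d' (i x) s <= _).
    by rewrite xE.
  by rewrite ler_piMr.
have [u uP] := choice close.
have K0' : 0 < K' by apply: lt_le_trans K1'.
have cu : dist_cauchy d u.
  move=> e e0; have [N HN] := inv_succ_lt (divr_gt0 e0 K0').
  exists N => n m Nn Nm; rewrite -di.
  apply: le_lt_trans (quasi_ptolemaic_triangle gd' nd' K1' pK' _ z' _) _.
  rewrite mulrC -ltr_pdivlMr// gt_max (d'C z').
  by rewrite !(lt_trans (uP _))// HN.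
exists u => //.
have [l ul] := cauchy_cvg cu.
suff -> : z' = l by [].
apply/esym/(gauge_eq0 gd'); apply/le_anti; rewrite gauge_ge0// andbT.
apply/ler_addgt0Pr => e /inv_succ_lt[N HN]; rewrite add0r.
apply: (cvgr_to_le (ul z')); exists N => // n Nn.
exact/ltW/(lt_trans (uP n))/HN.
Qed.

Let cvg_approx (f : Z -> R) (u : nat -> Z) y :
  (forall e, 0 < e -> exists N, forall n, (N <= n)%N ->
    uniform_approx d f (u n) e) ->
  d (u n) y @[n --> \oo] --> f y.
Proof.
move=> H; apply/cvgrPdist_le => e /H[N HN].
by exists N => // n Nn; exact: HN.
Qed.

(* The function of the distances from [z'] to [Z] is in the completion. *)
Let trace z' : exists f : Zbar, forall y, sval f y = d' z' (i y).
Proof.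
have [u cu ul] := dense_seq z'.
have [f fP] := dist_cauchy_limit unif cu; exists f => y.
apply: cvg_uniq (@cvg_approx _ _ y fP) (ul (i y)) => n.
by rewrite di.
Qed.

(** The isometry from [Z'] to the completion. *)
Let G z' : Zbar := sval (cid (trace z')).

Let GE z' y : sval (G z') y = d' z' (i y).
Proof. exact: (svalP (cid (trace z'))). Qed.

Let G_dist z' w' : dbar (G z') (G w') = d' z' w'.
Proof.
have [u cu ul] := dense_seq w'.
have [f fP] := dist_cauchy_limit unif cu.
have -> : G w' = f.
  apply: completion_eq => y; rewrite GE.
  apply: cvg_uniq (ul (i y)) (@cvg_approx _ _ y fP) => n.
  by rewrite di.
have C : dbar (iZ (u n)) (G z') @[n --> \oo] --> dbar f (G z').
  apply/cvgrPdist_le => e /fP[N HN]; exists N => // n Nn.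
  by apply: completion_dist_lip => //; exact: HN.
have [_ dbarC _] := completion_gauge gd unif.
rewrite dbarC d'C; apply: cvg_uniq C (ul z') => n.
by rewrite dbarC completion_dist_embedr// GE d'C.
Qed.

Let G_surj f : exists z', G z' = f.
Proof.
have [z' z'P] := cauchy_cvg (approx_seq_cauchy gd f).
exists z'; apply: completion_eq => y; rewrite GE.
have C : d (approx_seq f n) y @[n --> \oo] --> sval f y.
  apply/cvgrPdist_le => e /inv_succ_lt[N Ne]; exists N => // n Nn.
  exact: le_trans (approx_seqP f n y) (ltW (Ne n Nn)).
apply: cvg_uniq (z'P (i y)) C => n.
by rewrite di.
Qed.

Let F f : Z' := sval (cid (G_surj f)).
Let FK f : G (F f) = f. Proof. exact: (svalP (cid (G_surj f))). Qed.

Let G_inj z' w' : G z' = G w' -> z' = w'.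
Proof.
move=> E; apply: (gauge_eq0 gd').
by rewrite -G_dist E; have [->] := completion_gauge gd unif.
Qed.

(** The last clause expresses that the points of [Z'] are determined by their
    distances to the image of [Z]. *)
Lemma completion_universal : exists f : Zbar -> Z',
  [/\ moebius_equivalence (moebius_of dbar) M' f, i = f \o iZ &
      forall f1 f2 : Zbar -> Z',
       (forall h y, d' (f1 h) (i y) = d' (f2 h) (i y)) -> f1 = f2].
Proof.
have Fd f g : d' (F f) (F g) = dbar f g by rewrite -G_dist !FK.
have F_inj : injective F by move=> f g E; rewrite -(FK f) E FK.
exists F; split.
- split; first by exists G => // z'; apply: G_inj; rewrite FK.
  split=> // P aP.
  rewrite Md'; first exact: moebius_of_map.
  move=> a b c ab bc ac [E1 E2]; apply: (aP a b c ab bc ac).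
  by move: E1 E2; rewrite !tnth_map => /F_inj -> /F_inj ->.
- apply/funext => x /=; apply: G_inj; rewrite FK; apply: completion_eq => y.
  by rewrite GE di.
- move=> f1 f2 H; apply/funext => h; apply: G_inj; apply: completion_eq => y.
  by rewrite !GE.
Qed.

End Universal.

Theorem theorem3 (R : realType) (Z : Type)
    (M : 4.-tuple Z -> 3.-tuple (\bar R))
    (hM : is_moebius M) (hsym : symmetry_condition M) :
  exists (Zbar : Type) (Mbar : 4.-tuple Zbar -> 3.-tuple (\bar R))
         (iZ : Z -> Zbar),
    [/\ is_strong_moebius Mbar,
        moebius_complete Mbar,
        moebius_embedding M Mbar iZ,
        moebius_dense Mbar (range iZ) &
        forall (Z' : Type) (M' : 4.-tuple Z' -> 3.-tuple (\bar R))
               (i : Z -> Z'),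
          is_strong_moebius M' ->
          moebius_complete M' ->
          moebius_embedding M M' i ->
          moebius_dense M' (range i) ->
          exists! f : Zbar -> Z',
            moebius_equivalence Mbar M' f /\ i = f \o iZ].
Proof.
have [[p [q [r [pq qr pr]]]] _ _ _ _] := hM.
have pqr : nondegenerate [tuple p; q; r] by apply/nondegenerate3.
have [gd nd Md] := normal_gaugeP hM pqr.
set d := normal_gauge M p q r in gd nd Md.
have bd := symmetry_balanced gd Md hsym.
have [K K1 pK] := balanced_quasi_ptolemaic gd bd.
have unif := balanced_uniform gd nd K1 pK bd.
pose dbar := @completion_dist R Z d.
pose iZ := @completion_embed R Z d.
have embZ : moebius_embedding M (moebius_of dbar) iZ.
  split; first exact: completion_embed_inj.
  move=> P aP; rewrite Md//; apply: moebius_of_map => x y.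
  exact: completion_dist_embed.
exists (completion d), (moebius_of dbar), iZ; split=> //.
- exact: (completion_is_strong gd K1 pK unif pq qr pr).
- exact: (completion_complete gd nd K1 pK unif pq qr pr).
- exact: (completion_dense gd nd unif pq qr pr).
move=> Z' M' i [hM' cM'] compl' embi dense'.
have pqr' : nondegenerate [tuple i p; i q; i r].
  have [i_inj _] := embi.
  by apply/nondegenerate3; split=> /i_inj.
have [gd' nd' Md'] := normal_gaugeP hM' pqr'.
have [K' K1' pK'] := corner_quasi_ptolemaic gd' Md' cM'.
have di := normal_gauge_map embi pqr.
have [f [fE fi uniq]] := completion_universal gd unif pq qr pr hM' compl'
  dense' gd' nd' Md' K1' pK' di.
exists f; split=> // f2 [[_ f2E] f2i]; apply: uniq => h y.
(* The distance from [g h] to [i y] does not depend on [g]. *)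
have nat g : moebius_embedding (moebius_of dbar) M' g -> i = g \o iZ ->
    normal_gauge M' (i p) (i q) (i r) (g h) (i y) =
    normal_gauge (moebius_of dbar) (iZ p) (iZ q) (iZ r) h (iZ y).
  move=> gE -> /=; apply: normal_gauge_map => //.
  by apply/nondegenerate3; have [iZ_inj _] := embZ; split=> /iZ_inj.
have [_ fE'] := fE.
by rewrite (nat f fE' fi) (nat f2 f2E f2i).
Qed.
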